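(* Let $J$ and $X$ be finite and $0<\lambda,\delta<1$. Fix any stationary (pure-strategy) MPE $(\phi,z)$, and let $S(\alpha)=C_{\phi,z}(\phi(\alpha);\alpha)$ and $\mathcal Z=\{\alpha\in\Delta^n:(1-\delta)S(\alpha)=h(\alpha)\}$. (i) The set $\mathcal Z$ is nonempty and compact. Every accumulation point of every equilibrium path $(\alpha_t)$ belongs to $\mathcal Z$. (ii) If $p\in\mathcal Z$ and $x\in z^*(p)$, then $U(p,x)=h(p)=M(x)$, and for every $i\in J$, $p^i>0$ implies $u_i(x)=M(x)$. (iii) Suppose each implementable action has a unique maximizing pure worldview, i.e. $|\arg\max_{j\in J}u_j(x)|=1$ for every $x\in X^I$. Then from every initial state there is $j\in J$ such that $\alpha_t\to\alpha(j)$. (This holds for every $\lambda\in(0,1)$, and the maximizing worldview is not required to find the action optimal.) The same conclusions hold for every stationary randomized MPE $\Pi$, with $S(\alpha)=\int C_\Pi(\beta;\alpha)\,\kappa_\alpha(d\beta)$ in the definition of $\mathcal Z$: the set $\mathcal Z$ is nonempty and compact; for each fixed initial state, almost surely every accumulation point of $(\alpha_t)$ belongs to $\mathcal Z$; the restriction in (ii) holds at every $p\in\mathcal Z$ and every $x\in z^*(p)$; and under the unique-maximizer condition of (iii), for each fixed initial state, almost surely $(\alpha_t)$ converges to a pure worldview, which may be random.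
   Context: $J=\{1,\ldots,n\}$ and $X$ are nonempty finite sets (pure worldviews and actions) with payoffs $u_j(x)\in\mathbb R$; $M(x)=\max_{j\in J}u_j(x)$. $\Delta^n=\{\alpha\in\mathbb R^n:\alpha^j\ge0,\ \sum_j\alpha^j=1\}$; $\alpha(j)$ is the vertex with weight one on $j$ (pure worldview). $U(\alpha,x)=\sum_j\alpha^ju_j(x)$, $z^*(\alpha)=\arg\max_{x\in X}U(\alpha,x)$, $h(\alpha)=\max_{x\in X}U(\alpha,x)$, $X^I=\bigcup_{\alpha\in\Delta^n}z^*(\alpha)$ (implementable actions). Pure strategies: a stationary pure strategy is a pair of arbitrary maps $\phi:\Delta^n\to\Delta^n$, $z:\Delta^n\to X$ (no continuity or measurability assumed). With $\phi^k$ the $k$-fold iterate, $$C_{\phi,z}(\beta;\alpha)=\sum_{k=0}^\infty\delta^k\big[(1-\lambda)U(\phi^k(\beta),z(\phi^k(\beta)))+\lambda U(\alpha,z(\phi^k(\beta)))\big].$$ A stationary MPE is a pair $(\phi,z)$ such that for every $\alpha$: $z(\alpha)\in z^*(\alpha)$, and $C_{\phi,z}(\phi(\alpha);\alpha)\ge C_{\phi,z}(\beta;\alpha)$ for every $\beta\in\Delta^n$. The path from $\alpha_0$ is $\alpha_{t+1}=\phi(\alpha_t)$, $x_t=z(\alpha_t)$. Randomized strategies: a stationary randomized strategy is a Borel probability kernel $\alpha\mapsto\Pi_\alpha$ from $\Delta^n$ to $X\times\Delta^n$, with marginals $s_\alpha$ on $X$ and $\kappa_\alpha$ on $\Delta^n$.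 From a fixed $\alpha_0$, conditional on the history $(\alpha_0,x_0,\ldots,x_{t-1},\alpha_t)$, the pair $(x_t,\alpha_{t+1})$ has law $\Pi_{\alpha_t}$; $\mathbb E_\beta$ is expectation when $\alpha_0=\beta$. Put $$C_\Pi(\beta;\alpha)=\mathbb E_\beta\sum_{k=0}^\infty\delta^k\big[(1-\lambda)U(\alpha_k,x_k)+\lambda U(\alpha,x_k)\big],\qquad S(\alpha)=\int C_\Pi(\beta;\alpha)\,\kappa_\alpha(d\beta).$$ $\Pi$ is a stationary randomized MPE if for every $\alpha$: $s_\alpha(z^*(\alpha))=1$ and $S(\alpha)\ge C_\Pi(\gamma;\alpha)$ for every $\gamma\in\Delta^n$. *)

(* Defs.v *)
From HB Require Import structures.
From mathcomp Require Import all_boot all_order all_algebra.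
From mathcomp Require Import all_classical all_reals all_analysis.

Set Implicit Arguments.
Unset Strict Implicit.
Unset Printing Implicit Defensive.

Import Order.TTheory GRing.Theory Num.Theory.
Import numFieldNormedType.Exports.

Local Open Scope classical_set_scope.
Local Open Scope ring_scope.

(* Nonempty finite types: the chosen point only witnesses nonemptiness. *)
#[short(type="pointedFinType")]
HB.structure Definition PointedFinite := {T of Finite T & Pointed T}.

(* A finite type with the discrete sigma-algebra. *)
Definition discrete_space (X : pointedFinType) : Type := X.
HB.instance Definition _ (X : pointedFinType) :=
  PointedFinite.copy (discrete_space X) X.
HB.instance Definition _ (X : pointedFinType) :=
  @isMeasurable.Build default_measure_display (discrete_space X)
    discrete_measurable discrete_measurable0 discrete_measurableC
    discrete_measurableU.

(* The index type 'I_n.+1 makes the set of pure worldviews nonempty, so the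
   simplex below is the (n+1)-vertex one, inside R^(n+1). *)
Definition simplex_set (R : realType) (n : nat) : set 'rV[R]_n.+1 :=
  [set a | (forall j, 0 <= a ord0 j) /\ \sum_j a ord0 j = 1].

Definition simplex (R : realType) (n : nat) : Type :=
  set_type (@simplex_set R n).

Lemma vertex_subproof (R : realType) (n : nat) (j : 'I_n.+1) :
  delta_mx ord0 j \in @simplex_set R n.
Proof.
rewrite inE; split => [i|]; first by rewrite mxE ler0n.
rewrite (bigD1 j) // mxE !eqxx /= big1 ?addr0 // => i /negbTE ij.
by rewrite mxE ij andbF.
Qed.

Definition vertex (R : realType) (n : nat) (j : 'I_n.+1) : simplex R n :=
  exist _ (delta_mx ord0 j) (vertex_subproof R j).

(* Subspace topology inherited from R^(n+1). *)
HB.instance Definition _ (R : realType) (n : nat) :=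
  PseudoMetric.copy (simplex R n) (set_type (@simplex_set R n)).
HB.instance Definition _ (R : realType) (n : nat) :=
  isPointed.Build (simplex R n) (vertex R ord0).
(* Borel sigma-algebra. *)
HB.instance Definition _ (R : realType) (n : nat) :=
  @isMeasurable.Build (sigma_display (@open (simplex R n))) (simplex R n)
    <<s @open (simplex R n) >> (@sigma_algebra0 _ setT _)
    (@sigma_algebraC _ _) (@sigma_algebra_bigcup _ setT _).

Definition weight (R : realType) (n : nat) (alpha : simplex R n)
  (j : 'I_n.+1) : R := (\val alpha : 'rV[R]_n.+1) ord0 j.

Section Payoffs.
Context {R : realType} {n : nat} {X : pointedFinType}.
Variable u : 'I_n.+1 -> X -> R.

Definition utility (alpha : simplex R n) (x : X) : R :=
  \sum_j weight alpha j * u j x.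

Definition best_actions (alpha : simplex R n) : set X :=
  [set x | forall y, utility alpha y <= utility alpha x].

(* The default of each iterated max is one of the terms. *)
Definition best_utility (alpha : simplex R n) : R :=
  \big[Num.max/utility alpha point]_x utility alpha x.

Definition max_payoff (x : X) : R := \big[Num.max/u ord0 x]_j u j x.

Definition implementable (x : X) : Prop := exists alpha, best_actions alpha x.

Definition unique_maximizers : Prop :=
  forall x, implementable x -> #|[pred j | [forall i, u i x <= u j x]]| = 1%N.

Variables lam delta : R.

(* The discounted value, to a decision maker at alpha, of the path
   (a_k, x_k)_k. *)
Definition discounted_value (a : nat -> simplex R n) (x : nat -> X)
    (alpha : simplex R n) : R :=
  limn (series (fun k => delta ^+ k *
    ((1 - lam) * utility (a k) (x k) + lam * utility alpha (x k)))).

Definition stationary_set (S : simplex R n -> R) : set (simplex R n) :=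
  [set alpha | (1 - delta) * S alpha = best_utility alpha].

Section Pure.
Variables (phi : simplex R n -> simplex R n) (z : simplex R n -> X).

Definition pure_path (alpha0 : simplex R n) (t : nat) : simplex R n :=
  iter t phi alpha0.

Definition pure_value (beta alpha : simplex R n) : R :=
  discounted_value (pure_path beta) (z \o pure_path beta) alpha.

Definition pure_MPE : Prop := forall alpha,
  best_actions alpha (z alpha) /\
  forall beta, pure_value beta alpha <= pure_value (phi alpha) alpha.

Definition pure_S (alpha : simplex R n) : R := pure_value (phi alpha) alpha.

End Pure.

Section Randomized.
Variable Pi : R.-pker (simplex R n) ~> (discrete_space X * simplex R n)%type.
Context {d : measure_display} {Omega : measurableType d}.
Variables (a : nat -> {mfun Omega >-> simplex R n})
          (x : nat -> {mfun Omega >-> discrete_space X}).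

(* The sigma-algebra generated by a_0, x_0, ..., x_(t-1), a_t. *)
Definition history (t : nat) : set (set Omega) :=
  <<s (\bigcup_(k in [set k | (k <= t)%N])
         preimage_set_system setT (a k) measurable) `|`
      (\bigcup_(k in [set k | (k < t)%N])
         preimage_set_system setT (x k) measurable) >>.

(* Under P, the coordinates (a_t, x_t) form the path started at beta: the last
   clause says that Pi (a_t) is a version of the conditional law of
   (x_t, a_(t+1)) given the history. *)
Definition path_law (beta : simplex R n) (P : probability Omega R) : Prop :=
  P [set w | a 0%N w = beta] = 1%E /\
  forall t H B, history t H -> measurable B ->
    P (H `&` [set w | B (x t w, a t.+1 w)]) = (\int[P]_(w in H) Pi (a t w) B)%E.

(* P beta is the law of the path started at beta (such a family exists by the
   Ionescu-Tulcea theorem, e.g. on the space of all paths); the quantities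
   below depend on (Omega, a, x, P) only through these laws. *)
Variable P : simplex R n -> probability Omega R.

Definition rand_value (beta alpha : simplex R n) : R :=
  \int[P beta]_w discounted_value (fun k => a k w) (fun k => x k w) alpha.

Definition rand_S (alpha : simplex R n) : R :=
  fine (\int[pushforward (Pi alpha) snd]_beta (rand_value beta alpha)%:E).

Definition rand_MPE : Prop := forall alpha,
  pushforward (Pi alpha) fst (best_actions alpha : set (discrete_space X)) = 1%E
  /\ forall gamma, rand_value gamma alpha <= rand_S alpha.

End Randomized.

End Payoffs.

(* Main.v *)
(* Let h be the best utility and g = (1 - delta) S - h. Staying put is a feasible
   deviation, so g >= 0, while unfolding S one step gives
   (1 - delta) S(a) <= (1 - lam) E h(a') + lam E U(a, x') for the next state a'
   and its action x'. Hence both g(a) and h(a) - E U(a, x') are controlled by the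
   expected increment of h, which telescopes along a path: g(a_t) and
   h(a_t) - U(a_t, x_(t+1)) tend to 0. As S is a maximum of affine functions of
   the state, it is continuous, and accumulation points are zeros of g. At a zero
   p, if a pure worldview j valued an optimal action above h(p), small deviations
   from p towards j would force infinitely negative difference quotients of the
   convex function S. Under unique maximizers the zeros of g are therefore
   vertices, and the second vanishing quantity makes consecutive states lie near
   vertices that maximize the same action, hence near the same vertex. Pure and
   randomized equilibria share the deterministic part through [envelope]. *)
Require Import Defs.
From HB Require Import structures.
From mathcomp Require Import all_boot all_order all_algebra.
From mathcomp Require Import all_classical all_reals all_analysis.
From mathcomp Require Import ring lra measurable_realfun giry.

Set Implicit Arguments.
Unset Strict Implicit.
Unset Printing Implicit Defensive.

Import Order.TTheory GRing.Theory Num.Theory.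
Import numFieldNormedType.Exports.

Local Open Scope classical_set_scope.
Local Open Scope ring_scope.

(** * Affine functions on the simplex *)

Section Simplex.
Context {R : realType} {n : nat}.
Implicit Types (p q r : simplex R n) (v : 'I_n.+1 -> R).

Lemma simplexP p : @simplex_set R n (\val p).
Proof. by case: p => v hv; exact: (set_mem hv). Qed.

Lemma weight_ge0 p j : 0 <= weight p j.
Proof. by have [h _] := simplexP p; exact: h. Qed.

Lemma sum_weight p : \sum_j weight p j = 1.
Proof. by have [_ h] := simplexP p. Qed.

Lemma weight_le1 p j : weight p j <= 1.
Proof.
rewrite -(sum_weight p) (bigD1 j) //= lerDl sumr_ge0 // => i _.
exact: weight_ge0.
Qed.

Lemma weight_vertex (i j : 'I_n.+1) : weight (vertex R i) j = (j == i)%:R.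
Proof. by rewrite /weight /= mxE eqxx. Qed.

Lemma weight_inj p q : weight p =1 weight q -> p = q.
Proof.
move=> e; apply/val_inj/rowP => j; exact: e.
Qed.

Lemma simplex_of_weights v : (forall j, 0 <= v j) -> \sum_j v j = 1 ->
  exists p, forall j, weight p j = v j.
Proof.
move=> v0 v1.
have h : (\row_j v j) \in @simplex_set R n.
  rewrite inE; split=> [j|]; first by rewrite mxE.
  by under eq_bigr do rewrite mxE.
by exists (exist _ (\row_j v j) h : simplex R n) => j; rewrite /weight /= mxE.
Qed.

Lemma simplex_ballP p e q : 0 < e ->
  ball p e q <-> forall j, `|weight p j - weight q j| < e.
Proof.
move=> e0; split=> [[_ h] j|h].
  exact: (h ord0 j).
by split=> // i j; rewrite (ord1 i); exact: h.
Qed.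

(** The cube with sides [[0, 1]] is compact, and the simplex is its closed slice where the
    coordinates sum to one. *)
Lemma simplex_set_compact : compact (@simplex_set R n).
Proof.
pose K := [set v : 'rV[R]_n.+1 | forall j, `[0, 1]%classic (v ord0 j)].
have cK : compact K by apply: (@rV_compact R _ (fun=> `[0, 1]%classic)) => _;
  exact: segment_compact.
suff -> : @simplex_set R n = K `&` (fun v : 'rV[R]_n.+1 => \sum_j v ord0 j) @^-1` [set 1].
  apply: compact_closedI => //; apply: preimage_closed; last exact: closed_eq.
  have cs : continuous (fun v : 'rV[R]_n.+1 => \sum_j v ord0 j).
    by apply: (continuous_big (@add_continuous R)) => j _; exact: coord_continuous.
  by move=> v _; exact: cs.
apply/seteqP; split=> v [v0 v1]; split=> // j.
  rewrite /mkset in_itv /= v0 -v1 (bigD1 j) //= lerDl sumr_ge0 // => i _; exact: v0.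
  by have : v ord0 j \in `[0, 1] := v0 j; rewrite in_itv => /andP[].
Qed.

Lemma simplex_compact : compact [set: simplex R n].
Proof.
move=> F PF _.
(* The filter pushed forward to row vectors accumulates at some [v] of the compact set, which is
   then repackaged as a point of the subspace. *)
have [|v [vS cv]] := @simplex_set_compact (\val @ F) _.
  exact: (@filterS _ F _ setT _ (fun p _ => simplexP p) filterT).
have vm : v \in @simplex_set R n by rewrite inE.
exists (exist _ v vm : simplex R n); split=> // A B FA.
move=> /nbhs_ballP[e /= e0 eB].
have [|_ [[q Aq <-] vq]] := cv (\val @` A) (ball v e) _ (nbhsx_ballx _ _ e0).
  exact: (@filterS _ F _ A _ (fun q Aq => ex_intro2 _ _ q Aq erefl) FA).
by exists q; split=> //; exact: eB.
Qed.

Definition affine_form v p := \sum_j weight p j * v j.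

Lemma affine_vertex v j : affine_form v (vertex R j) = v j.
Proof.
rewrite /affine_form (bigD1 j) //= weight_vertex eqxx mul1r big1 ?addr0 // => i ij.
by rewrite weight_vertex (negbTE ij) mul0r.
Qed.

Lemma affine_mix v e p q r :
  (forall j, weight r j = (1 - e) * weight p j + e * weight q j) ->
  affine_form v r = (1 - e) * affine_form v p + e * affine_form v q.
Proof.
move=> hr; rewrite /affine_form !mulr_sumr -big_split /=.
by apply: eq_bigr => j _; rewrite hr; ring.
Qed.

Lemma affine_bound v (B : R) p : (forall j, `|v j| <= B) -> `|affine_form v p| <= B.
Proof.
move=> vB; apply: le_trans (ler_norm_sum _ _ _) _.
rewrite -[leRHS]mul1r -(sum_weight p) mulr_suml; apply: ler_sum => j _.
by rewrite normrM (ger0_norm (weight_ge0 _ _)) ler_wpM2l // weight_ge0.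
Qed.

Lemma affine_le_vertex v p : exists j, affine_form v p <= v j.
Proof.
pose k := [arg max_(i > ord0) v i]%O; exists k.
rewrite -[leRHS]mul1r -(sum_weight p) mulr_suml; apply: ler_sum => i _.
rewrite ler_wpM2l ?weight_ge0 // /k; by case: arg_maxP => // m _; apply.
Qed.

(** Comparing [f] at two points through the form that supports it at one of them bounds the
    difference by a uniformly bounded affine form, so [f] is Lipschitz. The supporting forms may be
    infinitely many. *)
Lemma max_affine_continuous (f : simplex R n -> R)
  (tau : simplex R n -> 'I_n.+1 -> R) (B : R) :
  (forall p j, `|tau p j| <= B) -> (forall p, f p = affine_form (tau p) p) ->
  (forall p q, affine_form (tau p) q <= f q) -> continuous f.
Proof.
move=> tauB fE fge p.
have B0 : 0 <= B by apply: le_trans (tauB p ord0).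
have lip q r (e : R) : (forall j, `|weight q j - weight r j| < e) ->
    f q - f r <= B * e * n.+1%:R.
  move=> h; apply: (@le_trans _ _ (affine_form (tau q) q - affine_form (tau q) r)).
    by rewrite fE lerB // -?fE.
  rewrite /affine_form -sumrB; apply: (@le_trans _ _ (\sum_(j < n.+1) B * e)).
    apply: ler_sum => j _; rewrite -mulrBl; apply: le_trans (ler_norm _) _.
    by rewrite normrM mulrC ler_pM // ltW.
  by rewrite big_const_ord iter_addr_0 mulr_natr.
apply/(@cvgrPdist_le _ _ _ _ (nbhs_filter p)) => e e0.
(* The [+ 1] keeps the denominator positive when [B] is zero. *)
have d0 : 0 < e / (B * n.+1%:R + 1).
  by rewrite divr_gt0 // ltr_wpDl // mulr_ge0.
have de : B * (e / (B * n.+1%:R + 1)) * n.+1%:R <= e.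
  rewrite mulrAC mulrCA ger_pMr // ler_pdivrMr ?mul1r ?lerDl //.
  by rewrite ltr_wpDl // mulr_ge0.
apply: (filterS _ (nbhsx_ballx p _ d0)) => q /(simplex_ballP _ _ d0) pq.
rewrite ler_norml; apply/andP; split.
  rewrite lerNl opprB; apply: le_trans (lip _ _ _ _) de => j.
  by rewrite distrC pq.
exact: le_trans (lip _ _ _ pq) de.
Qed.

Lemma affine_continuous v : continuous (affine_form v).
Proof.
apply: (@max_affine_continuous _ (fun=> v) (\sum_j `|v j|)) => // p j.
by rewrite (bigD1 j) //= lerDl sumr_ge0.
Qed.

Lemma weight_continuous j : continuous (fun p => weight p j).
Proof.
have -> : (fun p => weight p j) = affine_form (fun i => (i == j)%:R).
  apply/funext => p; rewrite /affine_form (bigD1 j) //= eqxx mulr1 big1 ?addr0 //.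
  by move=> i /negbTE ->; rewrite mulr0.
exact: affine_continuous.
Qed.

End Simplex.

(** * Best actions and the best utility *)

Section Payoff.
Context {R : realType} {n : nat} {X : pointedFinType} (u : 'I_n.+1 -> X -> R).
Implicit Types (p q : simplex R n) (x y : X).

Lemma utility_le_best p x : utility u p x <= best_utility u p.
Proof. exact: le_bigmax. Qed.

Lemma best_action_exists p : exists x, best_actions u p x.
Proof.
exists [arg max_(x > point) utility u p x]%O => y.
by case: arg_maxP => // x _; apply.
Qed.

Lemma best_utilityE p x : best_actions u p x -> best_utility u p = utility u p x.
Proof.
move=> bx; apply/eqP; rewrite eq_le utility_le_best andbT.
by apply/bigmax_leP; split=> [|y _]; exact: bx.
Qed.

Lemma best_actionsP p x : best_utility u p <= utility u p x -> best_actions u p x.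
Proof. by move=> h y; apply: le_trans h; exact: utility_le_best. Qed.

Lemma le_max_payoff i x : u i x <= max_payoff u x.
Proof. exact: le_bigmax. Qed.

Lemma max_payoff_le x (M : R) : (forall i, u i x <= M) -> max_payoff u x <= M.
Proof. by move=> h; apply/bigmax_leP; split=> [|i _]; exact: h. Qed.

Lemma payoff_bounded : exists2 B : R, 0 <= B & forall i x, `|u i x| <= B.
Proof.
exists (\sum_i \sum_x `|u i x|) => [|i x].
  by apply: sumr_ge0 => i _; exact: sumr_ge0.
rewrite (bigD1 i) //= (bigD1 x) //= -addrA lerDl addr_ge0 // sumr_ge0 // => k _.
exact: sumr_ge0.
Qed.

Lemma utility_bound (B : R) p x : (forall i x, `|u i x| <= B) -> `|utility u p x| <= B.
Proof. by move=> h; apply: (@affine_bound _ _ (fun j => u j x)) => j; exact: h. Qed.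

Lemma best_utility_bound (B : R) p : (forall i x, `|u i x| <= B) -> `|best_utility u p| <= B.
Proof.
by move=> h; have [x /best_utilityE ->] := best_action_exists p; exact: utility_bound.
Qed.

Lemma utility_continuous x : continuous (fun p => utility u p x).
Proof. exact: (@affine_continuous _ _ (fun j => u j x)). Qed.

Lemma best_utility_continuous : continuous (best_utility u).
Proof.
have [f fP] := choice best_action_exists.
have [B B0 uB] := payoff_bounded.
apply: (@max_affine_continuous _ _ _ (fun p j => u j (f p)) B) => [p j|p|p q].
- exact: uB.
- exact: best_utilityE.
- exact: utility_le_best.
Qed.

(** Actions that are nearly optimal close to [p] are exactly optimal at [p], because there are
    finitely many actions and the loss of each is continuous. *)
Lemma best_actions_near p : exists2 e : R, 0 < e & forall q y, ball p e q ->
  best_utility u q - utility u q y < e -> best_actions u p y.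
Proof.
have cg y : continuous (fun q => best_utility u q - utility u q y).
  by move=> q; exact: (cvgB (@best_utility_continuous q) (@utility_continuous y q)).
have loc y : exists e : R, 0 < e /\ (forall q, ball p e q ->
    best_utility u q - utility u q y < e -> best_actions u p y).
  have [b|nb] := pselect (best_actions u p y); first by exists 1; split.
  (* Near [p] the loss of a nonoptimal [y] stays above half its value at [p], so no smaller loss can
     occur there. *)
  have g0 : 0 < (best_utility u p - utility u p y) / 2.
    rewrite divr_gt0 // subr_gt0 ltNge; apply/negP => h.
    by apply: nb; exact: best_actionsP.
  have /(@cvgrPdist_lt _ _ _ _ (nbhs_filter p))/(_ _ g0) := cg y p.
  move=> /nbhs_ballP[e /= e0 eB].
  exists (Num.min e ((best_utility u p - utility u p y) / 2)).
  rewrite lt_min e0 g0; split=> // q pq; rewrite lt_min => /andP[_ small].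
  have : ball p e q by apply: le_ball pq; rewrite ge_min lexx.
  move=> /eB /=; rewrite ltr_norml => /andP[_ big].
  by exfalso; move: small big; lra.
have [f fP] := choice loc.
(* The smallest of the finitely many numbers serves every action, both as a radius and as a loss
   threshold. *)
exists (f [arg min_(y < point) f y]%O) => [|q y pq small].
  by have [] := fP [arg min_(y < point) f y]%O.
have [_ h] := fP y.
have le : f [arg min_(y < point) f y]%O <= f y by case: arg_minP => // i _; apply.
by apply: (h q); [exact: le_ball pq|exact: lt_le_trans small le].
Qed.

(** The best utility is a maximum of affine functions, hence is largest at a vertex. *)
Lemma best_utility_max_vertex : exists p, forall q, best_utility u q <= best_utility u p.
Proof.
pose k := [arg max_(j > ord0) best_utility u (vertex R j)]%O.
exists (vertex R k) => q.
have [x /best_utilityE ->] := best_action_exists q.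
have [j /le_trans] := affine_le_vertex (fun j => u j x) q; apply.
rewrite -(affine_vertex (fun j => u j x) j); apply: le_trans (utility_le_best _ x) _.
by rewrite /k; case: arg_maxP => // i _; apply.
Qed.

Lemma unique_maximizersP i j x : unique_maximizers u -> implementable u x ->
  u i x = max_payoff u x -> u j x = max_payoff u x -> i = j.
Proof.
move=> un /un/eq_leq/card_le1_eqP h iM jM.
by apply: h; rewrite inE; apply/forallP => k; rewrite (iM, jM) le_max_payoff.
Qed.

End Payoff.

(** * Accumulation points in the simplex *)

Section Clusters.
Context {R : realType} {n : nat}.

(** If [O] were not in [F], the restriction of [F] to the complement of [O] would be proper. By
    compactness it would accumulate somewhere; [F] accumulates there too, so [O] would be a
    neighbourhood of that point, which is absurd. *)
Lemma cluster_near (F : set_system (simplex R n)) (O : set (simplex R n)) :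
  ProperFilter F -> (forall p, cluster F p -> nbhs p O) -> F O.
Proof.
move=> PF hO; apply: contrapT => nFO.
have PG : ProperFilter (within (~` O) F).
  apply: Build_ProperFilter_ex.
  move=> A FA; apply: contrapT => /forallNP A0; apply: nFO.
  by apply: (@filterS _ F _ [set q | (~` O) q -> A q] _ _ FA) => p hA;
    apply: contrapT => /hA; exact: A0.
have [p [_ cp]] := @simplex_compact R n (within (~` O) F) PG filterT.
have cFp : cluster F p.
  move=> A B FA nB; apply: (cp A B) => //.
  by apply: filterS FA => q Aq _.
have [|q []] := cp (~` O) O _ (hO p cFp); last by [].
exact: withinT.
Qed.

Lemma cluster_zero (g : simplex R n -> R) (a : nat -> simplex R n) p :
  continuous g -> (forall e, 0 < e -> \forall t \near \oo, `|g (a t)| < e) ->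
  cluster (a @ \oo) p -> g p = 0.
Proof.
move=> cg ga cp; apply: contrapT => /eqP gp.
have e0 : 0 < `|g p| / 2 by rewrite divr_gt0 // normr_gt0.
have /(@cvgrPdist_lt _ _ _ _ (nbhs_filter p))/(_ _ e0) nb := cg p.
have [q [/= small near]] := cp [set q | `|g q| < `|g p| / 2] _ (ga _ e0) nb.
have := ler_normD (g p - g q) (g q); rewrite subrK; move: small near.
by move=> /= *; lra.
Qed.

End Clusters.

(** * Stationary states of a maximum of affine functions *)

Section Envelope.
Context {R : realType} {n : nat} {X : pointedFinType} (u : 'I_n.+1 -> X -> R).
Variables lam delta : R.
Implicit Types (p q : simplex R n) (x y : X).

(* [affine_form (tau q) p] is the value, to a decision maker at [p], of the
   continuation that the state [q] chooses; [s q] is the law of the action at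
   [q]. The last clause is the deviation of [p] to the state [q]. *)
Record envelope (S : simplex R n -> R) (tau : simplex R n -> 'I_n.+1 -> R)
    (s : simplex R n -> X -> R) : Prop := Envelope {
  tau_bounded : exists B : R, forall p j, `|tau p j| <= B ;
  envelopeE : forall p, S p = affine_form (tau p) p ;
  envelope_ge : forall p q, affine_form (tau q) p <= S p ;
  action_ge0 : forall p y, 0 <= s p y ;
  action_sum1 : forall p, \sum_y s p y = 1 ;
  action_best : forall p y, s p y != 0 -> best_actions u p y ;
  deviation_le : forall p q, (1 - lam) * best_utility u q +
    lam * (\sum_y s q y * utility u p y) + delta * affine_form (tau q) p <= S p }.

Hypotheses (lam01 : 0 < lam < 1) (delta01 : 0 < delta < 1).
Context {S : simplex R n -> R} {tau : simplex R n -> 'I_n.+1 -> R}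
  {s : simplex R n -> X -> R}.
Hypothesis env : envelope S tau s.

Let Z := stationary_set u delta S.

Definition gap (f : simplex R n -> R) p := (1 - delta) * f p - best_utility u p.

(** The action drawn at [q] is surely best at [q]. The case [q = p] gives the payoff of staying put;
    the case of [q] close to [p] is used for small deviations. *)
Lemma expected_best_utility p q : (forall y, best_actions u q y -> best_actions u p y) ->
  \sum_y s q y * utility u p y = best_utility u p.
Proof.
move=> qp; rewrite -[RHS]mul1r -(action_sum1 env q) mulr_suml.
apply: eq_bigr => y _; have [->|sy] := eqVneq (s q y) 0; first by rewrite !mul0r.
by rewrite (best_utilityE (qp _ (action_best env sy))).
Qed.

(** Deviating to [p] itself yields [best_utility u p] now and [S p] from the next period on. *)
Lemma gap_ge0 p : 0 <= gap S p.
Proof.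
have := deviation_le env p p; rewrite expected_best_utility // -(envelopeE env) /gap.
by move=> h; lra.
Qed.

Lemma gap_continuous : continuous (gap S).
Proof.
have [B tauB] := tau_bounded env.
have cS : continuous S.
  by apply: (max_affine_continuous tauB (envelopeE env)) => p q; exact: (envelope_ge env).
move=> p; apply: (@cvgB _ _ _ (nbhs p) (nbhs_filter p) (fun q => (1 - delta) * S q)).
  by apply: cvgMr; exact: cS.
exact: best_utility_continuous.
Qed.

Lemma stationary_setE p : Z p <-> gap S p = 0.
Proof.
by rewrite /Z /stationary_set /gap /=; split=> [->|/eqP]; rewrite ?subrr ?subr_eq0 // => /eqP.
Qed.

Lemma stationary_set_compact : compact Z.
Proof.
have -> : Z = setT `&` (gap S @^-1` [set 0]).
  by rewrite setTI; apply/seteqP; split=> p /stationary_setE.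
apply: compact_closedI; first exact: simplex_compact.
apply: preimage_closed; last exact: closed_eq.
by move=> p _; exact: gap_continuous.
Qed.

(* Moving from [p] towards the vertex [j] by [e] gives the deviation state [q];
   an extra payoff [D] there would force the difference quotients of the convex
   function [S] at [p] to grow by a fixed amount whenever the step is halved. *)
Lemma payoff_le_stationary p x j : Z p -> best_actions u p x ->
  u j x <= best_utility u p.
Proof.
move=> Zp bx; rewrite leNgt; apply/negP => Dpos.
have /andP[lam0 lam1] := lam01; have /andP[delta0 delta1] := delta01.
have hx := best_utilityE bx.
have [e1 e1pos near] := best_actions_near u p.
pose D := u j x - best_utility u p.
(* After a deviation from [p] to the state [e / 2] away towards [j], the flow gain
   [(1 - lam) * D * (e / 2)] must be offset by a continuation loss of at least [c * (e / 2)],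
   discounted by [delta]. *)
pose c := (1 - lam) * D / delta.
pose s0 := tau p j - S p.
have D0 : 0 < D by rewrite subr_gt0.
have c0 : 0 < c by rewrite divr_gt0 // ?mulr_gt0 //; lra.
have dc : delta * c = (1 - lam) * D by rewrite /c mulrC divfK //; lra.
pose mix (e : R) q := forall i, weight q i = (1 - e) * weight p i + e * weight (vertex R j) i.
have mixE e : 0 <= e <= 1 -> exists q, mix e q.
  move=> e01; apply: simplex_of_weights => [i|].
    by rewrite addr_ge0 // mulr_ge0 ?weight_ge0 //; lra.
  by rewrite big_split /= -!mulr_sumr !sum_weight; ring.
(* The first bound keeps the deviation state within [e1] of [p], the second keeps the mixtures
   inside the simplex. *)
pose e0 := Num.min (e1 / 2) (1 / 2).
have e0pos : 0 < e0 by rewrite /e0 lt_min; apply/andP; split; lra.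
have e0le : e0 <= e1 / 2 /\ e0 <= 1 / 2 by rewrite /e0 !ge_min !lexx orbT.
(* The supporting form [tau p] gives the slope bound [s0] at every step size. Passing from [e / 2]
   to [e] adds [c / 2] to the bound, so repeated passes make the quotient at the fixed step [e0]
   exceed every number. *)
have grow k : forall e q, 0 < e <= e0 -> mix e q ->
    e * (s0 + k%:R * (c / 2)) <= S q - S p.
  elim: k => [|k IH] e q /andP[epos ele] mq.
    have := envelope_ge env q p; rewrite (affine_mix _ mq) affine_vertex -(envelopeE env).
    by rewrite /s0; lra.
  have [q' mq'] : exists q', mix (e / 2) q' by apply: mixE; lra.
  have e2 : 0 < e / 2 <= e0 by lra.
  (* The actions taken at [q'] are still optimal at [p], so the term of the deviation weighted by
     [lam] costs [p] nothing. *)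
  have pq' y : best_actions u q' y -> best_actions u p y.
    move=> b; apply: (near q'); last by rewrite (best_utilityE b) subrr.
    apply/simplex_ballP => // i; rewrite mq' /mix.
    have -> : weight p i - ((1 - e / 2) * weight p i + e / 2 * weight (vertex R j) i) =
      e / 2 * (weight p i - weight (vertex R j) i) by ring.
    rewrite normrM ger0_norm; last by lra.
    have : `|weight p i - weight (vertex R j) i| <= 1.
      have := weight_ge0 p i; have := weight_le1 p i.
      have := weight_ge0 (vertex R j) i; have := weight_le1 (vertex R j) i.
      by rewrite ler_norml => *; apply/andP; split; lra.
    move: (`|_|) => w; nra.
  have dev := deviation_le env p q'; rewrite expected_best_utility // in dev.
  have hq' : best_utility u p + e / 2 * D <= best_utility u q'.
    apply: le_trans (utility_le_best u q' x).
    rewrite [utility u q' x](affine_mix (fun i => u i x) mq') affine_vertex.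
    have -> : affine_form (fun i => u i x) p = best_utility u p := esym hx.
    by rewrite /D; lra.
  have Sq := envelope_ge env q q'; rewrite (affine_mix _ mq) affine_vertex in Sq.
  have Sq' := envelopeE env q'; rewrite (affine_mix _ mq') affine_vertex in Sq'.
  have ih := IH _ _ e2 mq'.
  have zp : (1 - delta) * S p = best_utility u p := Zp.
  set A := affine_form (tau q') p in dev Sq Sq'.
  have Ale : A <= S p - c * (e / 2).
    have : delta * A <= delta * (S p - c * (e / 2)).
      rewrite mulrBr mulrA dc.
      have : (1 - lam) * (best_utility u p + e / 2 * D) <= (1 - lam) * best_utility u q'.
        by rewrite ler_wpM2l //; lra.
      lra.
    by rewrite ler_pM2l //; lra.
  (* As [q'] is the midpoint of [p] and [q], the form supporting [S] at [q'] gives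
     [S q >= 2 * S q' - A]; the bound on [A] supplies the extra [c / 2]. *)
  rewrite -natr1; lra.
(* The number [b] is the index at which the bound of [grow] equals the actual quotient at step [e0];
   any integer above it is contradictory. *)
have [q mq] : exists q, mix e0 q by apply: mixE; lra.
pose b := ((S q - S p) / e0 - s0) / (c / 2).
have := grow (Num.bound `|b|) e0 q _ mq; rewrite e0pos lexx => /(_ isT).
have : b < (Num.bound `|b|)%:R.
  by apply: le_lt_trans (ler_norm _) (archi_boundP _).
rewrite /b ltr_pdivrMr; last by lra.
rewrite ltrBlDl ltr_pdivrMr // mulrC; lra.
Qed.

(** The best utility is the average under [p] of payoffs that never exceed it, so each pure
    worldview of positive weight attains it. The same upper bound makes it the maximal payoff. *)
Lemma stationary_payoffs p x : Z p -> best_actions u p x ->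
  [/\ utility u p x = best_utility u p, best_utility u p = max_payoff u x &
      forall i, 0 < weight p i -> u i x = max_payoff u x].
Proof.
move=> Zp bx; have hx := best_utilityE bx.
have le j : u j x <= best_utility u p := payoff_le_stationary j Zp bx.
have eM : best_utility u p = max_payoff u x.
  apply/eqP; rewrite eq_le max_payoff_le // andbT hx.
  rewrite -[leRHS]mul1r -(sum_weight p) mulr_suml; apply: ler_sum => j _.
  by rewrite ler_wpM2l ?weight_ge0 // le_max_payoff.
split=> // i pi; apply/eqP; rewrite eq_le le_max_payoff /= leNgt -eM; apply/negP => lt.
suff : utility u p x < best_utility u p by rewrite hx ltxx.
rewrite -[ltRHS]mul1r -(sum_weight p) mulr_suml /utility (bigD1 i) //= [ltRHS](bigD1 i) //=.
apply: ltr_leD; first by rewrite ltr_pM2l.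
by apply: ler_sum => j _; rewrite ler_wpM2l ?weight_ge0.
Qed.

(** At a maximizer of the best utility no later state can improve on staying. The hypothesis
    expresses this, and each kind of equilibrium proves it from its own one-step bound. *)
Lemma stationary_set_nonempty :
  (forall p, (forall q, best_utility u q <= best_utility u p) ->
     (1 - delta) * S p <= best_utility u p) -> Z !=set0.
Proof.
move=> h; have [p pmax] := best_utility_max_vertex u; exists p.
by apply/eqP; rewrite eq_le h //= -subr_ge0; exact: gap_ge0.
Qed.

(** All pure worldviews in the support of [p] maximize the payoff of one action optimal at [p], so
    the support is a single point. *)
Lemma stationary_vertex p : unique_maximizers u -> Z p -> exists j, p = vertex R j.
Proof.
move=> un Zp; have [x bx] := best_action_exists u p.
have [_ _ hM] := stationary_payoffs Zp bx.
have [i pi] : exists i, 0 < weight p i.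
  apply: contrapT => /forallNP h; have := sum_weight p; rewrite big1 => [/esym/eqP|i _].
    by rewrite oner_eq0.
  by apply/eqP; rewrite eq_le weight_ge0 leNgt andbT; apply/negP; exact: h.
have p0 j : j != i -> weight p j = 0.
  move=> ji; apply/eqP; rewrite eq_le weight_ge0 leNgt andbT; apply/negP => pj.
  have := unique_maximizersP un (ex_intro _ p bx) (hM _ pj) (hM _ pi).
  by move/eqP: ji.
exists i; apply: weight_inj => j; rewrite weight_vertex.
have [->|/p0 //] := eqVneq j i.
by rewrite -(sum_weight p) (bigD1 i) //= big1 ?addr0 // => k; exact: p0.
Qed.

(* Two consecutive states near stationary vertices [j] and [k] share the action
   [x (t + 1)] as an optimal one, so both maximize its payoff and [j = k]. *)
Lemma cvg_vertex (a : nat -> simplex R n) (x : nat -> X) : unique_maximizers u ->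
  (forall t, best_actions u (a t) (x t)) ->
  (forall e, 0 < e -> \forall t \near \oo, `|gap S (a t)| < e) ->
  (forall e, 0 < e -> \forall t \near \oo,
     best_utility u (a t) - utility u (a t) (x t.+1) < e) ->
  exists j, a @ \oo --> vertex R j.
Proof.
move=> un bx ga ha.
have clZ p : cluster (a @ \oo) p -> Z p.
  by move=> cp; apply/stationary_setE; apply: cluster_zero ga cp; exact: gap_continuous.
have near j : exists e : R, 0 < e /\ (forall q y,
    ball (vertex R j) e q -> best_utility u q - utility u q y < e ->
    best_actions u (vertex R j) y).
  by have [e e0 eP] := best_actions_near u (vertex R j); exists e.
have [f fP] := choice near.
pose m := [arg min_(j < ord0) f j]%O.
(* Below [f m], nearly optimal actions are optimal at the nearby vertex; [1 / 2] makes the balls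
   around distinct vertices disjoint. *)
pose e := Num.min (f m) (1 / 2).
have e0 : 0 < e by rewrite lt_min (fP m).1; lra.
have ef j : e <= f j.
  by rewrite ge_min /m; case: arg_minP => // i _ /(_ j isT) ->.
have e12 : e <= 1 / 2 by rewrite ge_min lexx orbT.
have nearP j q y : ball (vertex R j) e q -> best_utility u q - utility u q y < e ->
    best_actions u (vertex R j) y.
  by move=> /(le_ball (ef j)) h small; apply: ((fP j).2 _ _ h); exact: lt_le_trans small (ef j).
have sep i j q : ball (vertex R i) e q -> ball (vertex R j) e q -> i = j.
  move=> /(simplex_ballP _ _ e0)/(_ i) hi /(simplex_ballP _ _ e0)/(_ i) hj.
  apply/eqP/negPn/negP => ij; move: hi hj; rewrite !weight_vertex eqxx (negbTE ij) mulr1n mulr0n.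
  by rewrite !ltr_norml => /andP[? ?] /andP[? ?]; lra.
(* All accumulation points are stationary vertices, so the path eventually stays in the union of the
   balls around them. *)
have caught : \forall t \near \oo, exists2 j, Z (vertex R j) & ball (vertex R j) e (a t).
  apply: (@cluster_near _ _ (a @ \oo) [set q | exists2 j, Z (vertex R j) & ball (vertex R j) e q]).
  move=> p /clZ Zp; have [j pj] := stationary_vertex un Zp.
  apply: filterS (nbhsx_ballx p _ e0) => q pq; exists j; rewrite -pj //.
have [T _ TP] : \forall t \near \oo, (exists2 j, Z (vertex R j) & ball (vertex R j) e (a t)) /\
    best_utility u (a t) - utility u (a t) (x t.+1) < e.
  by apply: filterI caught (ha _ e0).
have [[j Zj aTj] _] := TP T (leqnn T).
have stay t : (T <= t)%N -> ball (vertex R j) e (a t).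
  elim: t => [|t IH]; first by rewrite leqn0 => /eqP <-.
  rewrite leq_eqVlt => /predU1P[<- //|Tt]; have atj := IH Tt.
  have [_ small] := TP t Tt.
  have [[k Zk atk] _] := TP t.+1 (leqW Tt).
  have bj := nearP _ _ _ atj small.
  have bk : best_actions u (vertex R k) (x t.+1).
    by apply: (nearP _ _ _ atk); rewrite (best_utilityE (bx t.+1)) subrr.
  suff -> : j = k by [].
  have [_ _ hj] := stationary_payoffs Zj bj; have [_ _ hk] := stationary_payoffs Zk bk.
  have im : implementable u (x t.+1) by exists (vertex R j).
  apply: (unique_maximizersP un im); first apply: hj; last apply: hk.
    by rewrite weight_vertex eqxx.
  by rewrite weight_vertex eqxx.
(* The path ends up in the ball around [vertex R j], so that vertex is its only accumulation point,
   and compactness turns this into convergence. *)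
exists j => O nO; apply: (@cluster_near _ _ (a @ \oo)) => p cp.
have [k pk] := stationary_vertex un (clZ p cp).
suff -> : p = vertex R j by [].
have [] := cp [set q | ball (vertex R j) e q] (ball p e) _ (nbhsx_ballx p _ e0).
  by exists T => // t /= /stay.
by move=> q [/= qj]; rewrite pk => qk; rewrite (sep _ _ _ qj qk).
Qed.

End Envelope.

(** * Pure equilibria *)

Section Discounted.
Context {R : realType} {n : nat} {X : pointedFinType} (u : 'I_n.+1 -> X -> R).
Variables lam delta : R.
Hypotheses (lam01 : 0 < lam < 1) (delta01 : 0 < delta < 1).
Implicit Types (p q : simplex R n) (a : nat -> simplex R n) (x : nat -> X).

Definition flow_payoff p (y : X) q := (1 - lam) * utility u p y + lam * utility u q y.

Lemma flow_payoff_bound (B : R) p y q : (forall i y, `|u i y| <= B) ->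
  `|flow_payoff p y q| <= B.
Proof.
move=> uB; have /andP[l0 l1] := lam01; have l1' : 0 <= 1 - lam by lra.
apply: le_trans (ler_normD _ _) _; rewrite !normrM (ger0_norm l1') (ger0_norm (ltW l0)).
have -> : B = (1 - lam) * B + lam * B by ring.
by apply: lerD; [apply: (ler_wpM2l l1')|apply: (ler_wpM2l (ltW l0))]; exact: utility_bound.
Qed.

Lemma flow_payoff_affine p y q :
  flow_payoff p y q = \sum_j weight q j * flow_payoff p y (vertex R j).
Proof.
have uv j : utility u (vertex R j) y = u j y by exact: (affine_vertex (u^~ y)).
under eq_bigr do rewrite /flow_payoff uv mulrDr [X in _ + X]mulrCA.
rewrite big_split /= /flow_payoff; congr (_ + _).
  by rewrite -mulr_suml sum_weight mul1r.
by rewrite -mulr_sumr; congr (_ * _).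
Qed.

Lemma discounted_value_cvg a x q :
  cvgn (series (fun k => delta ^+ k * flow_payoff (a k) (x k) q)).
Proof.
have /andP[d0 d1] := delta01; have [B B0 uB] := payoff_bounded u.
apply: normed_cvg; apply: (@series_le_cvg _ _ (geometric B delta)) => [k|k|k|].
- exact: normr_ge0.
- by rewrite /geometric /= mulr_ge0 // exprn_ge0 // ltW.
- rewrite /geometric /= normrM ger0_norm ?exprn_ge0 ?(ltW d0) // mulrC.
  by rewrite ler_wpM2r ?exprn_ge0 ?(ltW d0) // flow_payoff_bound.
- by apply: is_cvg_geometric_series; rewrite ger0_norm ?(ltW d0).
Qed.

Lemma discounted_value_rec a x q : discounted_value u lam delta a x q =
  flow_payoff (a 0%N) (x 0%N) q +
  delta * discounted_value u lam delta (a \o succn) (x \o succn) q.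
Proof.
apply/cvg_lim => //; rewrite -cvg_shiftS.
have -> : [sequence series (fun k => delta ^+ k * flow_payoff (a k) (x k) q) m.+1]_m =
   (fun m => flow_payoff (a 0%N) (x 0%N) q +
     delta * series (fun k => delta ^+ k * flow_payoff (a k.+1) (x k.+1) q) m).
  apply/funext => m; rewrite /series /= big_nat_recl // expr0 mul1r mulr_sumr.
  by congr (_ + _); apply: eq_bigr => k _; rewrite exprS mulrA.
apply: cvgD; first exact: cvg_cst.
by apply: cvgMr; exact: (@discounted_value_cvg (a \o succn) (x \o succn)).
Qed.

(** The decision maker's state enters each flow payoff affinely; the finite sum over vertices
    commutes with the limit of the series. *)
Lemma discounted_value_affine a x q : discounted_value u lam delta a x q =
  affine_form (fun j => discounted_value u lam delta a x (vertex R j)) q.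
Proof.
apply/cvg_lim => //.
have -> : series (fun k => delta ^+ k *
      ((1 - lam) * utility u (a k) (x k) + lam * utility u q (x k))) =
   (fun m => \sum_j weight q j *
     series (fun k => delta ^+ k * flow_payoff (a k) (x k) (vertex R j)) m).
  apply/funext => m; under [RHS]eq_bigr do rewrite mulr_sumr.
  rewrite exchange_big /=; apply: eq_bigr => k _.
  rewrite -/(flow_payoff _ _ _) flow_payoff_affine mulr_sumr.
  by apply: eq_bigr => j _; rewrite mulrCA.
apply: (cvg_big (@add_continuous R)) => j _.
by apply: cvgMr; exact: discounted_value_cvg.
Qed.

Lemma discounted_value_split a x q N : discounted_value u lam delta a x q =
  \sum_(k < N) delta ^+ k * flow_payoff (a k) (x k) q +
  delta ^+ N * discounted_value u lam delta (fun k => a (N + k)%N) (fun k => x (N + k)%N) q.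
Proof.
elim: N => [|N IH]; first by rewrite big_ord0 add0r expr0 mul1r.
have shift (T : Type) (f : nat -> T) :
    (fun k => f (N + k)%N) \o succn = (fun k => f (N.+1 + k)%N).
  by apply/funext => k; rewrite /= addnS.
by rewrite IH discounted_value_rec big_ord_recr !shift !addn0 mulrDr addrA exprSr mulrA.
Qed.

Lemma discounted_value_bound (B : R) a x q : (forall i y, `|u i y| <= B) ->
  `|discounted_value u lam delta a x q| <= B / (1 - delta).
Proof.
move=> uB; have /andP[d0 d1] := delta01.
have B0 : 0 <= B by apply: le_trans (uB ord0 point).
have le m : `|series (fun k => delta ^+ k * flow_payoff (a k) (x k) q) m| <= B / (1 - delta).
  apply: le_trans (ler_norm_sum _ _ _) _.
  apply: (@le_trans _ _ (series (geometric B delta) m)).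
    apply: ler_sum => k _; rewrite /geometric /= normrM ger0_norm ?exprn_ge0 ?(ltW d0) //.
    by rewrite mulrC ler_wpM2r ?exprn_ge0 ?(ltW d0) // flow_payoff_bound.
  rewrite geometric_seriesE ?(lt_eqF d1) // /= ler_wpM2r //; first by rewrite invr_ge0; lra.
  by rewrite ler_piMr // gerBl exprn_ge0 // ltW.
rewrite ler_norml; apply/andP; split.
  by apply: limr_ge; [exact: discounted_value_cvg|];
    apply: nearW => m; have := le m; rewrite ler_norml => /andP[].
by apply: limr_le; [exact: discounted_value_cvg|];
  apply: nearW => m; have := le m; rewrite ler_norml => /andP[].
Qed.

End Discounted.

(** A bounded monotone sequence converges. This is applied to the best utility along pure paths and
    to partial sums of random series. *)
Lemma increments_vanish {R : realType} (v : nat -> R) (B e : R) :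
  nondecreasing_seq v -> (forall t, v t <= B) -> 0 < e ->
  \forall t \near \oo, v t.+1 - v t < e.
Proof.
move=> vi vB e0.
have cv : cvgn v.
  by apply: nondecreasing_is_cvgn => //; exists B => _ [t _ <-].
have c0 : (v \o succn \- v) @ \oo --> limn v - limn v.
  by apply: cvgB; [rewrite (_ : v \o succn = [sequence v m.+1]_m) // cvg_shiftS|].
rewrite subrr in c0.
have /cvgrPdist_lt/(_ _ e0) := c0; apply: filterS => t /=.
by rewrite sub0r normrN; apply: le_lt_trans; exact: ler_norm.
Qed.

(** * One-step inequalities along a pure equilibrium path *)

Section PureEquilibrium.
Context {R : realType} {n : nat} {X : pointedFinType} (u : 'I_n.+1 -> X -> R).
Variables lam delta : R.
Hypotheses (lam01 : 0 < lam < 1) (delta01 : 0 < delta < 1).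
Variables (phi : simplex R n -> simplex R n) (z : simplex R n -> X).
Hypothesis mpe : pure_MPE u lam delta phi z.
Implicit Types (p q : simplex R n).

Let value := pure_value u lam delta phi z.
Let S := pure_S u lam delta phi z.

Lemma pure_value_rec q p : value q p =
  (1 - lam) * best_utility u q + lam * utility u p (z q) + delta * value (phi q) p.
Proof.
have shift : pure_path phi q \o succn = pure_path phi (phi q).
  by apply/funext => k; rewrite /= /pure_path -iterS iterSr.
rewrite /value /pure_value (discounted_value_rec u lam01 delta01) shift.
by rewrite -compA shift (best_utilityE (mpe q).1).
Qed.

(** The chosen continuation at [q] is the path from [phi q], and the law of the action is the point
    mass at [z q]. *)
Lemma pure_envelope : envelope u lam delta S
  (fun q j => value (phi q) (vertex R j)) (fun q y => (y == z q)%:R).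
Proof.
have tauE p q : value (phi q) p = affine_form (fun j => value (phi q) (vertex R j)) p.
  exact: discounted_value_affine.
split.
- have [B _ uB] := payoff_bounded u; exists (B / (1 - delta)) => p j.
  exact: discounted_value_bound.
- by move=> p; exact: tauE.
- by move=> p q; rewrite -tauE; exact: (mpe p).2.
- by move=> p y; exact: ler0n.
- by move=> p; rewrite (bigD1 (z p)) //= eqxx big1 ?addr0 // => y /negbTE ->.
- by move=> p y; have [->|] := eqVneq y (z p); [move=> _; exact: (mpe p).1|rewrite eqxx].
- move=> p q; rewrite -tauE (bigD1 (z q)) //= eqxx mul1r big1 ?addr0.
    by rewrite -pure_value_rec; exact: (mpe p).2.
  by move=> y /negbTE ->; rewrite mul0r.
Qed.

(** Unfolding [S p] at [phi p] leaves the continuation from [phi (phi p)], worth at most [S p] to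
    [p] because moving there directly is a possible deviation. *)
Lemma pure_S_le p : (1 - delta) * S p <=
  (1 - lam) * best_utility u (phi p) + lam * utility u p (z (phi p)).
Proof.
have : value (phi (phi p)) p <= S p := (mpe p).2 _.
have -> : S p = value (phi p) p by [].
have /andP[d0 d1] := delta01.
rewrite -(ler_pM2l d0) => h; have := pure_value_rec (phi p) p; lra.
Qed.

(** By [pure_S_le], the gap plus [lam] times the loss of the next action at [p] is at most the
    right-hand side. Both terms are nonnegative, so each is bounded alone. *)
Lemma pure_increment p :
  gap u delta S p <= (1 - lam) * (best_utility u (phi p) - best_utility u p) /\
  lam * (best_utility u p - utility u p (z (phi p))) <=
    (1 - lam) * (best_utility u (phi p) - best_utility u p).
Proof.
have := pure_S_le p; have := gap_ge0 pure_envelope p; rewrite /gap.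
have := utility_le_best u p (z (phi p)); have /andP[l0 l1] := lam01.
by rewrite -(ler_pM2l l0) => *; split; lra.
Qed.

Lemma pure_path_increment p e : 0 < e -> \forall t \near \oo,
  best_utility u (pure_path phi p t.+1) - best_utility u (pure_path phi p t) < e.
Proof.
have [B _ uB] := payoff_bounded u; have /andP[l0 l1] := lam01.
(* The loss bound forces the best utility to be nondecreasing along the path. *)
apply: (@increments_vanish _ (fun t => best_utility u (pure_path phi p t)) B).
  apply/nondecreasing_seqP => t; have [_] := pure_increment (pure_path phi p t).
  have := utility_le_best u (pure_path phi p t) (z (phi (pure_path phi p t))).
  rewrite -subr_ge0 -(pmulr_rge0 _ l0) => h0 /(le_trans h0).
  by rewrite pmulr_rge0 ?subr_ge0 // subr_gt0.
by move=> t; apply: le_trans (ler_norm _) _; exact: best_utility_bound.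
Qed.

Lemma pure_gap_vanish p e : 0 < e ->
  \forall t \near \oo, `|gap u delta S (pure_path phi p t)| < e.
Proof.
have /andP[l0 l1] := lam01; move=> e0; apply: filterS (pure_path_increment p e0) => t lt.
rewrite ger0_norm; last exact: (gap_ge0 pure_envelope).
have [le _] := pure_increment (pure_path phi p t); apply: le_lt_trans le _.
have [_] := pure_increment (pure_path phi p t).
have := utility_le_best u (pure_path phi p t) (z (phi (pure_path phi p t))).
rewrite -subr_ge0 -(pmulr_rge0 _ l0) => h0 /(le_trans h0).
have l1' : 0 < 1 - lam by lra.
rewrite pmulr_rge0 // => h1; rewrite /= in lt *; nra.
Qed.

Lemma pure_loss_vanish p e : 0 < e -> \forall t \near \oo,
  best_utility u (pure_path phi p t) -
    utility u (pure_path phi p t) (z (pure_path phi p t.+1)) < e.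
Proof.
have /andP[l0 l1] := lam01; move=> e0.
apply: filterS (pure_path_increment p (mulr_gt0 l0 e0)) => t /= lt.
have [_ le] := pure_increment (pure_path phi p t).
have l1' : 0 < 1 - lam by lra.
rewrite -(ltr_pM2l l0); apply: le_lt_trans le _.
have := mulr_gt0 l0 e0; nra.
Qed.

Lemma pure_equilibrium (Z := stationary_set u delta S) :
  [/\ Z !=set0 /\ compact Z,
      forall alpha0, cluster (pure_path phi alpha0 @ \oo) `<=` Z,
      forall p x, Z p -> best_actions u p x ->
        [/\ utility u p x = best_utility u p,
            best_utility u p = max_payoff u x &
            forall i, 0 < weight p i -> u i x = max_payoff u x] &
      unique_maximizers u ->
        forall alpha0, exists j, pure_path phi alpha0 @ \oo --> vertex R j].
Proof.
have env := pure_envelope; have /andP[l0 l1] := lam01.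
split.
- split; last exact: (stationary_set_compact env).
  apply: (stationary_set_nonempty env) => p pmax; apply: le_trans (pure_S_le p) _.
  have l1' : 0 <= 1 - lam by lra.
  have := ler_wpM2l l1' (pmax (phi p)).
  have := ler_wpM2l (ltW l0) (utility_le_best u p (z (phi p))); lra.
- move=> p q cq; apply/stationary_setE.
  by apply: cluster_zero cq; [exact: (gap_continuous env)|exact: pure_gap_vanish].
- by move=> p x; exact: (stationary_payoffs lam01 delta01 env).
- move=> un p; apply: (cvg_vertex lam01 delta01 env (x := z \o pure_path phi p)) => //.
  + by move=> t; exact: (mpe _).1.
  + exact: pure_gap_vanish.
  + exact: pure_loss_vanish.
Qed.

End PureEquilibrium.

(** * Means of bounded measurable functions and kernels *)

Section BoundedMeasurable.
Context {d : measure_display} {T : measurableType d} {R : realType}.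
Implicit Types f g : T -> R.

(** A class closed under the operations below, whose members are integrable for every measure of
    mass one; this spares integrability conditions later. *)
Definition bounded_mfun f : Prop :=
  measurable_fun setT f /\ exists B : R, forall x, `|f x| <= B.

Lemma bounded_mfun_cst (c : R) : bounded_mfun (fun=> c).
Proof. by split; [exact: measurable_cst|exists `|c|]. Qed.

Lemma bounded_mfunD f g : bounded_mfun f -> bounded_mfun g ->
  bounded_mfun (fun x => f x + g x).
Proof.
move=> [mf [B fB]] [mg [C gC]]; split; first exact: measurable_funD.
by exists (B + C) => x; apply: le_trans (ler_normD _ _) _; exact: lerD.
Qed.

Lemma bounded_mfunM f g : bounded_mfun f -> bounded_mfun g ->
  bounded_mfun (fun x => f x * g x).
Proof.
move=> [mf [B fB]] [mg [C gC]]; split; first exact: measurable_funM.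
by exists (B * C) => x; rewrite normrM; exact: ler_pM.
Qed.

Lemma bounded_mfunZ (c : R) f : bounded_mfun f -> bounded_mfun (fun x => c * f x).
Proof. exact: bounded_mfunM (bounded_mfun_cst c). Qed.

Lemma bounded_mfunB f g : bounded_mfun f -> bounded_mfun g ->
  bounded_mfun (fun x => f x - g x).
Proof.
move=> bf /(bounded_mfunZ (-1)) bg.
have -> : (fun x => f x - g x) = (fun x => f x + -1 * g x).
  by apply/funext => x; rewrite mulN1r.
exact: bounded_mfunD.
Qed.

Lemma bounded_mfun_sum (I : Type) (r : seq I) (F : I -> T -> R) :
  (forall i, bounded_mfun (F i)) -> bounded_mfun (fun x => \sum_(i <- r) F i x).
Proof.
move=> bF; elim: r => [|i r IH].
  by under eq_fun do rewrite big_nil; exact: bounded_mfun_cst.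
by under eq_fun do rewrite big_cons; exact: bounded_mfunD.
Qed.

Lemma bounded_mfun_comp {d' : measure_display} {T' : measurableType d'}
  (f : T' -> R) (h : T -> T') : measurable_fun setT f ->
  (exists B : R, forall x, `|f x| <= B) -> measurable_fun setT h ->
  bounded_mfun (fun x => f (h x)).
Proof.
move=> mf [B fB] mh; split; last by exists B => x.
exact: (measurableT_comp mf mh).
Qed.

(** A measure with total mass one, so that the results cover both the path laws [P beta] and the
    kernel values [Pi b]. *)
Variable mu : {measure set T -> \bar R}.
Hypothesis mu1 : mu setT = 1%E.

Lemma bounded_mfun_integrable f D : measurable D -> bounded_mfun f ->
  mu.-integrable D (EFin \o f).
Proof.
move=> mD [mf [B fB]]; apply: measurable_bounded_integrable => //.
- have : (mu D <= mu setT)%E by apply: le_measure; rewrite ?inE.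
  by rewrite mu1 => /le_lt_trans; apply; rewrite ltry.
- exact: measurable_funTS.
- exists B; split; first exact: num_real.
  by move=> M BM x _; exact: le_trans (fB x) (ltW BM).
Qed.

Let int f : bounded_mfun f -> mu.-integrable setT (EFin \o f).
Proof. exact: bounded_mfun_integrable. Qed.

Lemma mean_cst (c : R) : \int[mu]_x c = c.
Proof. by rewrite Rintegral_cst // mu1 mulr1. Qed.

Lemma meanD f g : bounded_mfun f -> bounded_mfun g ->
  \int[mu]_x (f x + g x) = \int[mu]_x f x + \int[mu]_x g x.
Proof. by move=> bf bg; rewrite RintegralD //; exact: int. Qed.

Lemma meanZ (c : R) f : bounded_mfun f -> \int[mu]_x (c * f x) = c * \int[mu]_x f x.
Proof. by move=> bf; rewrite RintegralZl //; exact: int. Qed.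

Lemma meanB f g : bounded_mfun f -> bounded_mfun g ->
  \int[mu]_x (f x - g x) = \int[mu]_x f x - \int[mu]_x g x.
Proof. by move=> bf bg; rewrite RintegralB //; exact: int. Qed.

Lemma mean_sum (I : Type) (r : seq I) (F : I -> T -> R) :
  (forall i, bounded_mfun (F i)) ->
  \int[mu]_x (\sum_(i <- r) F i x) = \sum_(i <- r) \int[mu]_x F i x.
Proof.
move=> bF; elim: r => [|i r IH].
  by rewrite big_nil; under eq_Rintegral do rewrite big_nil; rewrite mean_cst.
rewrite big_cons -IH; under eq_Rintegral do rewrite big_cons.
by rewrite meanD //; exact: bounded_mfun_sum.
Qed.

Lemma mean_le f g : bounded_mfun f -> bounded_mfun g -> (forall x, f x <= g x) ->
  \int[mu]_x f x <= \int[mu]_x g x.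
Proof. by move=> bf bg fg; apply: le_Rintegral => //; exact: int. Qed.

Lemma mean_bound f (B : R) : bounded_mfun f -> (forall x, `|f x| <= B) ->
  `|\int[mu]_x f x| <= B.
Proof.
move=> bf fB; rewrite ler_norml -{1}(mean_cst (- B)) -{2}(mean_cst B).
apply/andP; split; apply: mean_le => //; try exact: bounded_mfun_cst.
  by move=> x; have := fB x; rewrite ler_norml => /andP[].
by move=> x; have := fB x; rewrite ler_norml => /andP[].
Qed.

Lemma mean_ae f g : bounded_mfun f -> bounded_mfun g ->
  {ae mu, forall x, f x = g x} -> \int[mu]_x f x = \int[mu]_x g x.
Proof.
move=> [mf _] [mg _] fg; congr fine; apply: ae_eq_integral => //.
- exact/measurable_EFinP.
- exact/measurable_EFinP.
- by apply: filterS fg => x /= ->.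
Qed.

(* The partial sums of a summable series of nonnegative means converge almost
   everywhere by monotone convergence. *)
Lemma ae_vanish (F : nat -> T -> R) (C : R) : (forall t, bounded_mfun (F t)) ->
  (forall t x, 0 <= F t x) -> (forall N, \sum_(t < N) \int[mu]_x F t x <= C) ->
  {ae mu, forall x, forall e, 0 < e -> \forall t \near \oo, F t x < e}.
Proof.
move=> bF F0 FC.
have mF t : measurable_fun setT (EFin \o F t) by apply/measurable_EFinP; exact: (bF t).1.
pose G x := (\sum_(0 <= t <oo) (F t x)%:E)%E.
have F0' t x : (0 <= (F t x)%:E)%E by rewrite lee_fin.
have intG : (\int[mu]_x G x <= C%:E)%E.
  rewrite integral_nneseries //.
  apply: lime_le; first by apply: is_cvg_nneseries => t _ _; apply: integral_ge0 => *; exact: F0'.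
  apply: nearW => N; rewrite big_mkord.
  rewrite (_ : (\sum_(i < N) _)%E = (\sum_(t < N) \int[mu]_x F t x)%:E) ?lee_fin //.
  rewrite -sumEFin; apply: eq_bigr => t _; rewrite /Rintegral fineK //.
  exact: integrable_fin_num (int (bF t)).
have G0 x : (0 <= G x)%E by exact: nneseries_ge0.
have iG : mu.-integrable setT G.
  apply/integrableP; split.
    by apply: ge0_emeasurable_sum => [k y _ _|k _]; [exact: F0'|exact: mF].
  under eq_integral do rewrite gee0_abs //.
  exact: le_lt_trans intG (ltry _).
apply: filterS (integrable_ae measurableT iG) => x /= /(_ I) finG e e0.
pose v N := \sum_(t < N) F t x.
have vi : nondecreasing_seq v.
  by apply/nondecreasing_seqP => N; rewrite /v big_ord_recr /= lerDl.
have vB N : v N <= fine (G x).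
  rewrite -lee_fin fineK // /v -sumEFin -(big_mkord xpredT (fun t => (F t x)%:E)).
  exact: nneseries_lim_ge.
apply: filterS (increments_vanish vi vB e0) => t.
by rewrite /v big_ord_recr /= [_ + F t x]addrC addrK.
Qed.

End BoundedMeasurable.

(** * Integration against probability kernels *)

Section KernelLaw.
Local Open Scope ereal_scope.
Context {d d' : measure_display} {T : measurableType d} {T' : measurableType d'}.
Context {R : realType}.
Variables (k : R.-pker T ~> T') (b : T).

(* A copy of [k b] carrying the subprobability structure of the Giry monad. *)
Definition kernel_law : set T' -> \bar R := k b.

HB.instance Definition _ := isMeasure.Build d' T' R kernel_law
  (measure0 (k b)) (measure_ge0 (k b)) (@measure_semi_sigma_additive _ _ _ (k b)).

Let kernel_law_le1 : kernel_law setT <= 1.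
Proof. by rewrite /kernel_law prob_kernel. Qed.

HB.instance Definition _ :=
  Measure_isSubProbability.Build d' T' R kernel_law kernel_law_le1.

End KernelLaw.

Section RestrictedLaw.
Local Open Scope ereal_scope.
Context {d : measure_display} {T : measurableType d} {R : realType}.
Variables (P : probability T R) (H : set T) (mH : measurable H).

(** The part of [P] carried by the event [H], as a subprobability over which the Giry monad can mix
    kernel values. *)
Definition restricted_law : set T -> \bar R := mrestr P mH.

HB.instance Definition _ := isMeasure.Build d T R restricted_law
  (measure0 (mrestr P mH)) (measure_ge0 (mrestr P mH))
  (@measure_semi_sigma_additive _ _ _ (mrestr P mH)).

Let restricted_law_le1 : restricted_law setT <= 1.
Proof. by rewrite /restricted_law /mrestr setTI; exact: probability_le1. Qed.

HB.instance Definition _ :=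
  Measure_isSubProbability.Build d T R restricted_law restricted_law_le1.

Lemma integral_restricted_law (f : T -> \bar R) :
  measurable_fun setT f -> (forall x, 0 <= f x) ->
  \int[restricted_law]_x f x = \int[P]_(x in H) f x.
Proof.
move=> mf f0.
have HC0 : restricted_law (~` H) = 0 by rewrite /restricted_law /mrestr setICl measure0.
rewrite (@ge0_negligible_integral _ _ _ restricted_law setT (~` H)) // ?setTD ?setCK; last first.
  exact: measurableC.
apply: eq_measure_integral => A mA AH.
by rewrite -[LHS]/(P (A `&` H)) setIidl.
Qed.

End RestrictedLaw.

Section KernelMean.
Context {d d' : measure_display} {T : measurableType d} {T' : measurableType d'}.
Context {R : realType}.
Variable k : R.-pker T ~> T'.
Implicit Types f : T' -> R.

Definition kernel_mean f (b : T) : R := \int[k b]_c f c.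

(** Adding the bound [B] makes [f] nonnegative, as the integration results for kernels and for the
    Giry monad require. *)
Lemma bounded_mfun_shift f : bounded_mfun f -> exists B : R,
  [/\ measurable_fun setT (fun c => (f c + B)%:E), forall c, 0 <= f c + B &
      forall c, `|f c| <= B].
Proof.
move=> [mf [B fB]]; exists B; split=> //.
  apply/measurable_EFinP; apply: measurable_funD => //.
by move=> c; have := fB c; rewrite ler_norml -(lerD2r B) addNr => /andP[].
Qed.

Lemma integral_shift f (B : R) b : bounded_mfun f ->
  (\int[k b]_c (f c + B)%:E)%E = (kernel_mean f b + B)%:E.
Proof.
move=> bf; have k1 : k b setT = 1%E by exact: prob_kernel.
have -> : kernel_mean f b + B = \int[k b]_c (f c + B).
  by rewrite meanD ?(mean_cst k1) //; exact: bounded_mfun_cst.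
rewrite /Rintegral fineK //.
apply: integrable_fin_num => //.
by apply: bounded_mfun_integrable => //; apply: bounded_mfunD => //; exact: bounded_mfun_cst.
Qed.

Lemma kernel_mean_bounded f : bounded_mfun f -> bounded_mfun (kernel_mean f).
Proof.
move=> bf; have [B [mB f0 fB]] := bounded_mfun_shift bf; split; last first.
  by exists B => b; apply: mean_bound => //; exact: prob_kernel.
have -> : kernel_mean f = (fun b => fine (\int[k b]_c (f c + B)%:E) - B).
  by apply/funext => b; rewrite integral_shift //= addrK.
apply: measurable_funB => //; apply: measurableT_comp => //.
apply: (@measurable_fun_integral_kernel _ _ _ _ _ (fun b => k b)) => //.
by move=> U mU; exact: measurable_kernel.
Qed.

Context {d0 : measure_display} {Omega : measurableType d0}.

(** This extends a conditional law from sets to bounded functions: on [H], the law of [y] is the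
    mixture of the measures [k (a w)]. *)
Lemma kernel_mean_law (P : probability Omega R) (H : set Omega) (a : Omega -> T)
  (y : Omega -> T') f : measurable H -> measurable_fun setT a -> measurable_fun setT y ->
  (forall B, measurable B -> P (H `&` y @^-1` B) = (\int[P]_(w in H) k (a w) B)%E) ->
  bounded_mfun f ->
  \int[P]_(w in H) f (y w) = \int[P]_(w in H) kernel_mean f (a w).
Proof.
move=> mH ma my law bf; have [B [mB f0 fB]] := bounded_mfun_shift bf.
have f0' c : (0 <= (f c + B)%:E)%E by rewrite lee_fin.
pose rho := restricted_law P mH.
have mk U : measurable U -> measurable_fun setT (fun w => k (a w) U).
  by move=> mU; apply: (measurableT_comp (measurable_kernel k _ mU)).
have mka : measurable_fun setT (fun w => kernel_law k (a w) : giry T' R).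
  by apply: measurable_giry_codensity.
have e1 : (\int[P]_(w in H) (f (y w) + B)%:E =
    \int[P]_(w in H) (kernel_mean f (a w) + B)%:E)%E.
  rewrite -(@integral_restricted_law _ _ _ P H mH (fun w => (f (y w) + B)%:E)) //; last first.
    exact: (measurableT_comp mB my).
  rewrite -(@ge0_integral_pushforward _ _ _ _ _ _ my rho setT (fun c => (f c + B)%:E)) //.
  (* By [law], the image of [rho] under [y] and the mixture of the kernel values agree on measurable
     sets, hence as integrators. *)
  transitivity (\int[giry_bind rho mka]_c (f c + B)%:E)%E.
    apply: eq_measure_integral => U mU _.
    have := giry_int_map mka rho (measurable_giry_ev mU) (fun mu => measure_ge0 mu U).
    rewrite /giry_bind /= /giry_join /= => ->.
    rewrite /pushforward /giry_int /giry_ev /=.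
    rewrite integral_restricted_law //; last exact: mk.
    by rewrite -law // /rho /restricted_law /mrestr setIC.
  rewrite -[LHS]/(giry_int _ _) giry_int_bind // /giry_int.
  transitivity (\int[rho]_w (kernel_mean f (a w) + B)%:E)%E.
    by apply: eq_integral => w _; exact: integral_shift.
  rewrite integral_restricted_law // => [|w]; last first.
    by rewrite -integral_shift // integral_ge0.
  apply/measurable_EFinP; apply: measurable_funD => //.
  exact: (measurableT_comp (kernel_mean_bounded bf).1 ma).
have P1 : P setT = 1%E by exact: probability_setT.
have bfy : bounded_mfun (fun w => f (y w)).
  by apply: bounded_mfun_comp => //; case: bf.
have bka : bounded_mfun (fun w => kernel_mean f (a w)).
  by have [mq bq] := kernel_mean_bounded bf; apply: bounded_mfun_comp.
have int g : bounded_mfun g -> P.-integrable H (EFin \o g).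
  by move=> bg; apply: bounded_mfun_integrable.
(* The integral of the shift [B] over [H] is the same on both sides and cancels. *)
move: (congr1 fine e1).
rewrite -![fine _]/(\int[P]_(w in H) _) !RintegralD //; try exact: int.
- exact: addIr.
- exact: (int _ (bounded_mfun_cst B)).
- exact: (int _ (bounded_mfun_cst B)).
Qed.

End KernelMean.

(** * Randomized equilibria *)

Section SimplexMeasurability.
Context {R : realType} {n : nat}.

Lemma simplex_open_measurable (O : set (simplex R n)) : open O -> measurable O.
Proof. exact: sub_sigma_algebra. Qed.

Lemma continuous_bounded_mfun (f : simplex R n -> R) : continuous f -> bounded_mfun f.
Proof.
move=> cf; split.
  move/continuousP : cf => cf; apply: (measurability _ (RGenOpens.measurableE R)).
  move=> _ [_ [a [b ->] <-]]; rewrite setTI; apply: simplex_open_measurable.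
  exact/cf/interval_open.
have cfT : compact (f @` setT).
  by apply: continuous_compact; [exact: continuous_subspaceT|exact: simplex_compact].
have [M [_ MP]] := compact_bounded cfT.
by exists (M + 1) => p; apply: (MP (M + 1)); rewrite ?ltrDl //; exists p.
Qed.

End SimplexMeasurability.

Section RandomizedEquilibrium.
Context {R : realType} {n : nat} {X : pointedFinType} (u : 'I_n.+1 -> X -> R).
Variables lam delta : R.
Hypotheses (lam01 : 0 < lam < 1) (delta01 : 0 < delta < 1).
Variable Pi : R.-pker (simplex R n) ~> (discrete_space X * simplex R n)%type.
Context {d : measure_display} {Omega : measurableType d}.
Variables (a : nat -> {mfun Omega >-> simplex R n})
          (x : nat -> {mfun Omega >-> discrete_space X}).
Variable P : simplex R n -> probability Omega R.
Hypothesis law : forall beta, path_law Pi a x beta (P beta).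
Hypothesis mpe : rand_MPE u lam delta Pi a x P.
Implicit Types (p q b : simplex R n) (y : X) (f g : simplex R n -> R).

(** The one-step transition operator of the chain of states. *)
Definition next_mean f : simplex R n -> R := kernel_mean Pi (fun c => f c.2).

Definition action_mean (v : X -> R) : simplex R n -> R :=
  kernel_mean Pi (fun c => v c.1).

Definition action_prob b y : R := action_mean (fun y' => (y' == y)%:R) b.

Let Pi1 b : Pi b setT = 1%E.
Proof. exact: prob_kernel. Qed.

Let P1 p : P p setT = 1%E.
Proof. exact: probability_setT. Qed.

Lemma discrete_bounded_mfun (v : X -> R) :
  bounded_mfun (v : discrete_space X -> R).
Proof.
split=> //; exists (\sum_y `|v y|) => y.
by rewrite (bigD1 y) //= lerDl sumr_ge0.
Qed.

Lemma fst_bounded_mfun (v : X -> R) :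
  bounded_mfun (fun c : discrete_space X * simplex R n => v c.1).
Proof.
have [mv bv] := discrete_bounded_mfun v.
exact: (bounded_mfun_comp mv bv measurable_fst).
Qed.

Lemma snd_bounded_mfun f : bounded_mfun f ->
  bounded_mfun (fun c : discrete_space X * simplex R n => f c.2).
Proof. by move=> [mf bf]; exact: (bounded_mfun_comp mf bf measurable_snd). Qed.

Lemma next_mean_bounded f : bounded_mfun f -> bounded_mfun (next_mean f).
Proof. by move=> bf; apply: kernel_mean_bounded; exact: snd_bounded_mfun. Qed.

Lemma action_mean_bounded v : bounded_mfun (action_mean v).
Proof. by apply: kernel_mean_bounded; exact: fst_bounded_mfun. Qed.

Lemma action_meanE v b : action_mean v b = \sum_y action_prob b y * v y.
Proof.
rewrite /action_prob /action_mean /kernel_mean.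
under [RHS]eq_bigr => y _.
  rewrite mulrC -(meanZ (Pi1 b)); last exact: (fst_bounded_mfun (fun y' => (y' == y)%:R)).
  over.
rewrite -(mean_sum (Pi1 b)); last first.
  by move=> y; apply: bounded_mfunZ; exact: (fst_bounded_mfun (fun y' => (y' == y)%:R)).
congr fine; apply: eq_integral => c _; congr EFin.
by rewrite (bigD1 c.1) //= eqxx mulr1 big1 ?addr0 // => y /negbTE;
  rewrite eq_sym => ->; rewrite mulr0.
Qed.

Lemma action_event_measurable y :
  measurable [set c : discrete_space X * simplex R n | c.1 = y].
Proof.
rewrite -[X in measurable X]setTI.
exact: (@measurable_fst _ _ (discrete_space X) (simplex R n) measurableT [set y] I).
Qed.

(** The best actions already carry mass one, which leaves none for an event disjoint from them. *)
Lemma action_event_null b y : ~ best_actions u b y -> Pi b [set c | c.1 = y] = 0%E.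
Proof.
move=> nb; have [+ _] := mpe b; rewrite /pushforward.
set F := fst @^-1` _ => F1.
have mF : measurable F.
  rewrite -[X in measurable X]setTI.
  exact: (@measurable_fst _ _ (discrete_space X) (simplex R n) measurableT _ I).
have mB := action_event_measurable y.
have : (Pi b ([set c | c.1 = y] `|` F) <= 1)%E.
  by rewrite -(Pi1 b); apply: le_measure; rewrite ?inE //; exact: measurableU.
rewrite measureU //; last first.
  by apply/seteqP; split=> // c [/= cy]; rewrite /F /= cy.
rewrite [X in (_ + X)%E]F1 -{2}(add0e 1%E) leeD2rE // => le0.
by apply/eqP; rewrite eq_le le0 measure_ge0.
Qed.

Lemma action_prob_best b y : action_prob b y != 0 -> best_actions u b y.
Proof.
apply: contraNP => nb; apply/eqP.
have -> : action_prob b y = \int[Pi b]_c (\1_[set c | c.1 = y] c).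
  congr fine; apply: eq_integral => c _; rewrite indicE; congr (_%:R%:E); congr nat_of_bool.
  by apply/eqP/idP; rewrite inE.
rewrite /Rintegral integral_indic //; last exact: action_event_measurable.
by rewrite setIT action_event_null.
Qed.

Lemma history_measurable t (H : set Omega) : history a x t H -> measurable H.
Proof.
apply: smallest_sub; first exact: sigma_algebra_measurable.
move=> A [[k _]|[k _]] [B mB <-]; rewrite setTI.
  exact: (@measurable_funPTI _ _ _ _ (a k) B mB).
exact: (@measurable_funPTI _ _ _ _ (x k) B mB).
Qed.

Lemma history_state t k A : measurable A -> (k <= t)%N ->
  history a x t [set w | A (a k w)].
Proof.
move=> mA kt; apply: sub_sigma_algebra; left; exists k => //.
by exists A => //; rewrite setTI.
Qed.

Lemma history_setT t : history a x t setT.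
Proof.
have -> : setT = [set w | [set: simplex R n] (a 0%N w)] by [].
exact: history_state.
Qed.

Lemma state_bounded_mfun t f : bounded_mfun f -> bounded_mfun (fun w => f (a t w)).
Proof. by move=> [mf bf]; apply: bounded_mfun_comp. Qed.

Lemma action_bounded_mfun t (v : X -> R) : bounded_mfun (fun w => v (x t w)).
Proof. by have [mv bv] := discrete_bounded_mfun v; exact: (bounded_mfun_comp mv bv). Qed.

Lemma transition_mean beta t (H : set Omega)
    (f : discrete_space X * simplex R n -> R) : history a x t H -> bounded_mfun f ->
  \int[P beta]_(w in H) f (x t w, a t.+1 w) =
  \int[P beta]_(w in H) kernel_mean Pi f (a t w).
Proof.
move=> hH bf; have mH := history_measurable hH.
apply: (@kernel_mean_law _ _ _ _ _ Pi _ _ (P beta) H (a t)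
  (fun w => (x t w, a t.+1 w)) f mH) => //.
- exact: measurable_fun_pair.
- by move=> B mB; exact: (law beta).2.
Qed.

Lemma mean_next beta t (H : set Omega) f : history a x t H -> bounded_mfun f ->
  \int[P beta]_(w in H) f (a t.+1 w) = \int[P beta]_(w in H) next_mean f (a t w).
Proof. by move=> hH bf; rewrite -(transition_mean beta hH (snd_bounded_mfun bf)). Qed.

Lemma mean_action beta t (H : set Omega) (v : X -> R) : history a x t H ->
  \int[P beta]_(w in H) v (x t w) = \int[P beta]_(w in H) action_mean v (a t w).
Proof. by move=> hH; rewrite -(transition_mean beta hH (fst_bounded_mfun v)). Qed.

Lemma iter_next_bounded k f : bounded_mfun f -> bounded_mfun (iter k next_mean f).
Proof. by move=> bf; elim: k => //= k IH; exact: next_mean_bounded. Qed.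

Lemma simplex_set1_measurable p : measurable [set p].
Proof.
have -> : [set p] = \bigcap_(j : 'I_n.+1) [set q | weight q j = weight p j].
  apply/seteqP; split=> [q -> //|q h]; apply: weight_inj => j; exact: h.
apply: fin_bigcap_measurable; first exact: finite_finset.
move=> j _; have [mw _] := continuous_bounded_mfun (@weight_continuous R n j).
by have := mw measurableT _ (measurable_set1 (weight p j)); rewrite setTI.
Qed.

(** Conditioning on the history before each step peels off one transition operator at a time, down
    to the almost surely constant initial state. *)
Lemma mean_state beta t f : bounded_mfun f ->
  \int[P beta]_w f (a t w) = iter t next_mean f beta.
Proof.
move=> bf; elim: t f bf => [|t IH] f bf; last first.
  by rewrite (mean_next _ (@history_setT t) bf) IH ?iterSr //; exact: next_mean_bounded.
rewrite -(mean_cst (P1 beta) (iter 0 next_mean f beta)).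
apply: mean_ae; [exact: state_bounded_mfun|exact: bounded_mfun_cst|].
have mS : measurable [set w | a 0%N w = beta].
  exact: (@measurable_funPTI _ _ _ _ (a 0%N) _ (simplex_set1_measurable beta)).
exists (~` [set w | a 0%N w = beta]); split.
- exact: measurableC.
- by have := probability_setC (P beta) mS; rewrite (law beta).1 subee.
- by move=> w /= + aw; apply; rewrite aw.
Qed.

(** For fixed [t] and [y], the event that [y] is not best at time [t] belongs to the history, and
    given it the kernel chooses [y] with probability zero. There are finitely many [y] and countably
    many [t]. *)
Lemma ae_best_actions beta :
  {ae P beta, forall w, forall t, best_actions u (a t w) (x t w)}.
Proof.
have mO y : measurable [set b | 0 < best_utility u b - utility u b y].
  apply: simplex_open_measurable.
  apply: (@open_comp _ _ (fun b => best_utility u b - utility u b y) [set r | 0 < r]).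
    move=> b _; apply: (@cvgB _ _ _ (nbhs b)); first exact: best_utility_continuous.
    exact: utility_continuous.
  exact: open_gt.
have nbP b y : ~ best_actions u b y <-> 0 < best_utility u b - utility u b y.
  split=> [nb|pos /best_utilityE e]; last by move: pos; rewrite e subrr ltxx.
  by rewrite subr_gt0 ltNge; apply/negP => le; apply: nb; exact: best_actionsP.
apply: ae_foralln => t.
pose N y := [set w | 0 < best_utility u (a t w) - utility u (a t w) y] `&`
  [set w | [set c : discrete_space X * simplex R n | c.1 = y] (x t w, a t.+1 w)].
have hH y : history a x t [set w | 0 < best_utility u (a t w) - utility u (a t w) y].
  exact: (history_state (mO y) (leqnn t)).
have mN y : measurable (N y).
  apply: measurableI; first exact: history_measurable (hH y).
  exact: (@measurable_funPTI _ _ _ _ (x t) [set y] I).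
have N0 y : P beta (N y) = 0%E.
  rewrite /N ((law beta).2 t _ _ (hH y) (action_event_measurable y)).
  by apply: integral0_eq => w /nbP /action_event_null.
have aeN : {ae P beta, forall w, forall y, ~ N y w}.
  apply: filter_forall => y; exists (N y); split=> // w /= nn.
  exact: contrapT.
apply: filterS aeN => w nN; apply: contrapT => /nbP pos; exact: (nN (x t w)).
Qed.

(** The expected flow payoff to [p] in a period that starts at [b]; the own-utility term is the best
    utility because the drawn action is surely best. *)
Definition reward p b :=
  (1 - lam) * best_utility u b + lam * action_mean (utility u p) b.

Let value q p := rand_value u lam delta a x P q p.

Let vS := rand_S u lam delta Pi a x P.

Lemma best_utility_bounded : bounded_mfun (best_utility u).
Proof. by apply: continuous_bounded_mfun; exact: best_utility_continuous. Qed.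

Lemma utility_bounded y : bounded_mfun (fun b => utility u b y).
Proof. by apply: continuous_bounded_mfun; exact: utility_continuous. Qed.

Lemma reward_bounded p : bounded_mfun (reward p).
Proof.
apply: bounded_mfunD; apply: bounded_mfunZ; first exact: best_utility_bounded.
exact: action_mean_bounded.
Qed.

Lemma flow_bounded k p : bounded_mfun (fun w => flow_payoff u lam (a k w) (x k w) p).
Proof.
apply: bounded_mfunD; apply: bounded_mfunZ; last exact: action_bounded_mfun.
(* Splitting over the finitely many actions gives products of a function of the action and a
   function of the state, each measurable. *)
have -> : (fun w => utility u (a k w) (x k w)) =
    (fun w => \sum_(y : X) (x k w == y)%:R * utility u (a k w) y).
  apply/funext => w; rewrite (bigD1 (x k w)) //= eqxx mul1r big1 ?addr0 // => y.
  by rewrite eq_sym => /negbTE ->; rewrite mul0r.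
apply: bounded_mfun_sum => y; apply: bounded_mfunM.
  exact: (@action_bounded_mfun k (fun y' => (y' == y)%:R)).
exact: (state_bounded_mfun k (utility_bounded y)).
Qed.

Lemma mean_flow beta k p :
  \int[P beta]_w flow_payoff u lam (a k w) (x k w) p = iter k next_mean (reward p) beta.
Proof.
have bh := state_bounded_mfun k best_utility_bounded.
have bu := @action_bounded_mfun k (utility u p).
rewrite -(mean_state beta k (reward_bounded p)).
transitivity (\int[P beta]_w ((1 - lam) * best_utility u (a k w) + lam * utility u p (x k w))).
  apply: mean_ae; first exact: flow_bounded.
    by apply: bounded_mfunD; apply: bounded_mfunZ.
  by apply: filterS (ae_best_actions beta) => w /(_ k) /best_utilityE ->.
have ba := state_bounded_mfun k (action_mean_bounded (utility u p)).
rewrite (meanD (P1 beta)); try exact: bounded_mfunZ.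
rewrite [RHS](meanD (P1 beta)); try exact: bounded_mfunZ.
rewrite (meanZ (P1 beta) _ bu) (meanZ (P1 beta) _ ba).
by rewrite (mean_action beta (utility u p) (@history_setT k)).
Qed.

Lemma discounted_value_bounded N p : bounded_mfun (fun w =>
  discounted_value u lam delta (fun k => a (N + k)%N w) (fun k => x (N + k)%N w) p).
Proof.
split; last first.
  have [B _ uB] := payoff_bounded u; exists (B / (1 - delta)) => w.
  exact: discounted_value_bound.
apply: (@measurable_fun_cvg _ _ _ setT (fun m w =>
  \sum_(0 <= k < m) delta ^+ k * flow_payoff u lam (a (N + k)%N w) (x (N + k)%N w) p)).
  move=> m; have [] // : bounded_mfun (fun w =>
    \sum_(0 <= k < m) delta ^+ k * flow_payoff u lam (a (N + k)%N w) (x (N + k)%N w) p).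
  by apply: bounded_mfun_sum => k; apply: bounded_mfunZ; exact: flow_bounded.
move=> w _.
exact: (@discounted_value_cvg _ _ _ u lam delta lam01 delta01
  (fun k => a (N + k)%N w) (fun k => x (N + k)%N w) p).
Qed.

(** The family [P] carries no measurability in the initial state. These truncations, built from the
    kernel alone, are measurable in it and converge uniformly to the value. *)
Let partial_value N p q := \sum_(k < N) delta ^+ k * iter k next_mean (reward p) q.

Lemma partial_value_bounded N p : bounded_mfun (partial_value N p).
Proof.
apply: bounded_mfun_sum => k; apply: bounded_mfunZ.
exact: iter_next_bounded (reward_bounded p).
Qed.

Lemma value_approx (B : R) N p q : (forall i y, `|u i y| <= B) ->
  `|value q p - partial_value N p q| <= delta ^+ N * (B / (1 - delta)).
Proof.
move=> uB; have /andP[d0 d1] := delta01.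
pose dv w := discounted_value u lam delta (fun k => a (N + k)%N w) (fun k => x (N + k)%N w) p.
have bdv : bounded_mfun dv := discounted_value_bounded N p.
have -> : value q p = partial_value N p q + delta ^+ N * \int[P q]_w dv w.
  rewrite /value /rand_value.
  under eq_Rintegral do rewrite (discounted_value_split u lam01 delta01 _ _ _ N).
  rewrite (meanD (P1 q)); last exact: bounded_mfunZ.
    rewrite (meanZ (P1 q)) //; congr (_ + _).
    rewrite (mean_sum (P1 q)) => [|k]; last by apply: bounded_mfunZ; exact: flow_bounded.
    apply: eq_bigr => k _; rewrite (meanZ (P1 q)) ?mean_flow //; exact: flow_bounded.
  by apply: bounded_mfun_sum => k; apply: bounded_mfunZ; exact: flow_bounded.
rewrite addrAC subrr add0r normrM ger0_norm ?exprn_ge0 ?(ltW d0) //.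
rewrite ler_wpM2l ?exprn_ge0 ?(ltW d0) //; apply: (mean_bound (P1 q) bdv) => w.
exact: discounted_value_bound.
Qed.

Lemma geometric_cvg0 (K : R) : (fun N => delta ^+ N * K) @ \oo --> (0 : R).
Proof.
have /andP[d0 d1] := delta01.
have := @cvg_geometric R K delta; rewrite ger0_norm ?(ltW d0) // => /(_ d1).
by under eq_fun do rewrite /geometric /= mulrC.
Qed.

Lemma value_bounded p : bounded_mfun (value ^~ p).
Proof.
have [B _ uB] := payoff_bounded u; split; last first.
  exists (B / (1 - delta)) => q; rewrite /value /rand_value.
  by apply: (mean_bound (P1 q) (discounted_value_bounded 0 p)) => w; exact: discounted_value_bound.
apply: (@measurable_fun_cvg _ _ _ setT (fun N => partial_value N p)).
  by move=> N; have [] := partial_value_bounded N p.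
move=> q _; apply/cvgrPdist_le => e e0.
have /cvgrPdist_le/(_ _ e0) := geometric_cvg0 (B / (1 - delta)).
apply: filterS => N /=; rewrite sub0r normrN => le.
by apply: le_trans (value_approx N p q uB) (le_trans (ler_norm _) le).
Qed.

Lemma next_meanD f g b : bounded_mfun f -> bounded_mfun g ->
  next_mean (fun q => f q + g q) b = next_mean f b + next_mean g b.
Proof.
by move=> bf bg; exact: (meanD (Pi1 b) (snd_bounded_mfun bf) (snd_bounded_mfun bg)).
Qed.

Lemma next_meanB f g b : bounded_mfun f -> bounded_mfun g ->
  next_mean (fun q => f q - g q) b = next_mean f b - next_mean g b.
Proof.
by move=> bf bg; exact: (meanB (Pi1 b) (snd_bounded_mfun bf) (snd_bounded_mfun bg)).
Qed.

Lemma next_meanZ (c : R) f b : bounded_mfun f ->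
  next_mean (fun q => c * f q) b = c * next_mean f b.
Proof. by move=> bf; exact: (meanZ (Pi1 b) c (snd_bounded_mfun bf)). Qed.

Lemma next_mean_cst (c : R) b : next_mean (fun=> c) b = c.
Proof. exact: (mean_cst (Pi1 b)). Qed.

Lemma next_mean_sum (I : Type) (r : seq I) (F : I -> simplex R n -> R) b :
  (forall i, bounded_mfun (F i)) ->
  next_mean (fun q => \sum_(i <- r) F i q) b = \sum_(i <- r) next_mean (F i) b.
Proof. by move=> bF; apply: (mean_sum (Pi1 b)) => i; exact: snd_bounded_mfun. Qed.

Lemma next_mean_le f g b : bounded_mfun f -> bounded_mfun g -> (forall q, f q <= g q) ->
  next_mean f b <= next_mean g b.
Proof.
move=> bf bg fg; apply: (mean_le (Pi1 b) (snd_bounded_mfun bf) (snd_bounded_mfun bg)).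
by move=> c; exact: fg.
Qed.

Lemma next_mean_bound (B : R) f b : bounded_mfun f -> (forall q, `|f q| <= B) ->
  `|next_mean f b| <= B.
Proof. by move=> bf fB; exact: (mean_bound (Pi1 b) (snd_bounded_mfun bf) (fun c => fB c.2)). Qed.

(** The truncations satisfy the recursion exactly, with [N] periods on the right and [N.+1] on the
    left, and lie geometrically close to the value. Letting [N] grow avoids shifting path laws. *)
Lemma value_rec q p : value q p = reward p q + delta * next_mean (value ^~ p) q.
Proof.
have [B B0 uB] := payoff_bounded u; have /andP[d0 d1] := delta01.
pose C := B / (1 - delta).
have C0 : 0 <= C by rewrite divr_ge0 // subr_ge0 ltW.
pose z := `|value q p - (reward p q + delta * next_mean (value ^~ p) q)|.
have zle N : z <= delta ^+ N * (2 * C).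
  have bp := partial_value_bounded N p; have bv := value_bounded p.
  have pS : partial_value N.+1 p q = reward p q + delta * next_mean (partial_value N p) q.
    rewrite /partial_value big_ord_recl expr0 mul1r /=; congr (_ + _).
    rewrite next_mean_sum => [|k]; last first.
      by apply: bounded_mfunZ; exact: iter_next_bounded (reward_bounded p).
    rewrite mulr_sumr; apply: eq_bigr => k _; rewrite next_meanZ.
      by rewrite exprS mulrA.
    exact: iter_next_bounded (reward_bounded p).
  have -> : z = `|(value q p - partial_value N.+1 p q) +
      delta * next_mean (fun b => partial_value N p b - value b p) q|.
    by rewrite next_meanB // /z pS; congr `|_|; ring.
  apply: le_trans (ler_normD _ _) _.
  have h1 : `|value q p - partial_value N.+1 p q| <= delta ^+ N * C.
    apply: le_trans (value_approx N.+1 p q uB) _.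
    by rewrite -/C ler_wpM2r // exprS ler_piMl ?exprn_ge0 ?(ltW d0) // ltW.
  have h2 : `|next_mean (fun b => partial_value N p b - value b p) q| <= delta ^+ N * C.
    apply: next_mean_bound => [|b]; first exact: bounded_mfunB.
    by rewrite distrC; exact: value_approx.
  rewrite normrM (ger0_norm (ltW d0)).
  have : delta * `|next_mean (fun b => partial_value N p b - value b p) q| <= delta ^+ N * C.
    apply: le_trans h2; rewrite ler_piMl //; exact: ltW.
  move: h1; lra.
have z0 : z <= 0.
  have := geometric_cvg0 (2 * C); apply: (@closed_cvg _ _ \oo _ _ (fun r => z <= r)).
    exact: closed_ge.
  exact: nearW.
by apply/eqP; rewrite -subr_eq0 -normr_le0.
Qed.

Lemma value_affine q p : value q p = affine_form (fun j => value q (vertex R j)) p.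
Proof.
rewrite /value /rand_value /affine_form.
under eq_Rintegral do rewrite (discounted_value_affine u lam01 delta01) /affine_form.
have bv j := discounted_value_bounded 0 (vertex R j).
rewrite (mean_sum (P1 q)) => [|j]; last exact: bounded_mfunZ (bv j).
by apply: eq_bigr => j _; rewrite (meanZ (P1 q) _ (bv j)).
Qed.

Lemma rand_SE p : vS p = next_mean (value ^~ p) p.
Proof.
rewrite /vS /rand_S; congr fine.
have bv := value_bounded p.
rewrite integral_pushforward //.
- by apply/measurable_EFinP; case: bv.
- exact: (bounded_mfun_integrable (Pi1 p) measurableT (snd_bounded_mfun bv)).
Qed.

Let tau q j := next_mean (value ^~ (vertex R j)) q.

Lemma next_value_affine q p : next_mean (value ^~ p) q = affine_form (tau q) p.
Proof.
rewrite /affine_form /tau.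
have scaled j : weight p j * next_mean (value ^~ (vertex R j)) q =
    next_mean (fun b => weight p j * value b (vertex R j)) q.
  by rewrite next_meanZ //; exact: value_bounded.
under eq_bigr do rewrite scaled.
rewrite -next_mean_sum => [|j]; last by apply: bounded_mfunZ; exact: value_bounded.
by congr (next_mean _ q); apply/funext => b; rewrite value_affine.
Qed.

(** Every deviation is worth at most [vS p] to [p], hence so is the lottery over states chosen at
    [q]. *)
Lemma next_value_le q p : next_mean (value ^~ p) q <= vS p.
Proof.
rewrite -(next_mean_cst (vS p) q); apply: next_mean_le => [||b].
- exact: value_bounded.
- exact: bounded_mfun_cst.
- exact: (mpe p).2.
Qed.

(** Averaging over the next state keeps the value affine in the decision maker's state, so [tau q]
    collects the values of the continuation lottery of [q] at the vertices. *)
Lemma rand_envelope : envelope u lam delta vS tau action_prob.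
Proof.
split.
- have [B _ uB] := payoff_bounded u; exists (B / (1 - delta)) => p j.
  apply: next_mean_bound => [|q]; first exact: value_bounded.
  rewrite /value /rand_value; apply: (mean_bound (P1 q) (discounted_value_bounded 0 _)) => w.
  exact: discounted_value_bound.
- by move=> p; rewrite rand_SE next_value_affine.
- by move=> p q; rewrite -next_value_affine; exact: next_value_le.
- move=> p y; apply: Rintegral_ge0 => c _; exact: ler0n.
- move=> p; under eq_bigr do rewrite -[action_prob _ _]mulr1.
  by rewrite -(action_meanE (fun=> 1)) /action_mean /kernel_mean (mean_cst (Pi1 p)).
- by move=> p y; exact: action_prob_best.
- move=> p q; rewrite -action_meanE -next_value_affine -/(reward p q) -value_rec.
  exact: (mpe p).2.
Qed.

Let next_utility p := \sum_y next_mean (fun b => action_prob b y) p * utility u p y.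

Lemma action_prob_bounded y : bounded_mfun (fun b => action_prob b y).
Proof. exact: (action_mean_bounded (fun y' => (y' == y)%:R)). Qed.

(** As in the pure case, with the continuation after the next state replaced by a lottery that is
    worth at most [vS p] to [p]. *)
Lemma rand_S_le p : (1 - delta) * vS p <=
  (1 - lam) * next_mean (best_utility u) p + lam * next_utility p.
Proof.
have bn := next_mean_bounded (value_bounded p).
have bh := best_utility_bounded.
have e : vS p = (1 - lam) * next_mean (best_utility u) p +
    lam * next_mean (action_mean (utility u p)) p + delta * next_mean (next_mean (value ^~ p)) p.
  have ba := action_mean_bounded (utility u p).
  rewrite rand_SE -(next_meanZ (1 - lam) p bh) -(next_meanZ lam p ba) -(next_meanZ delta p bn).
  rewrite -(next_meanD p (bounded_mfunZ (1 - lam) bh) (bounded_mfunZ lam ba)).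
  rewrite -(next_meanD p (reward_bounded p) (bounded_mfunZ delta bn)).
  by congr (next_mean _ p); apply/funext => b; rewrite value_rec.
have -> : next_utility p = next_mean (action_mean (utility u p)) p.
  rewrite (_ : action_mean (utility u p) = fun b => \sum_y utility u p y * action_prob b y).
    rewrite next_mean_sum => [|y]; last by apply: bounded_mfunZ; exact: action_prob_bounded.
    by apply: eq_bigr => y _; rewrite next_meanZ ?(mulrC (utility u p y)) //;
      exact: action_prob_bounded.
  by apply/funext => b; rewrite action_meanE; apply: eq_bigr => y _; rewrite mulrC.
have /andP[d0 d1] := delta01.
have : next_mean (next_mean (value ^~ p)) p <= vS p.
  rewrite -[leRHS](next_mean_cst _ p); apply: next_mean_le => //; first exact: bounded_mfun_cst.
  by move=> b; exact: next_value_le.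
rewrite -(ler_pM2l d0); lra.
Qed.

Lemma next_action_sum p : \sum_y next_mean (fun b => action_prob b y) p = 1.
Proof.
rewrite -next_mean_sum => [|y]; last exact: action_prob_bounded.
rewrite (_ : (fun b => _) = fun=> 1) ?next_mean_cst //; apply/funext => b.
exact: (action_sum1 rand_envelope).
Qed.

Lemma next_action_ge0 p y : 0 <= next_mean (fun b => action_prob b y) p.
Proof.
by apply: Rintegral_ge0 => c _; exact: (action_ge0 rand_envelope).
Qed.

Let loss p := best_utility u p - next_utility p.

(** The loss averages, over the law of the action drawn at the next state, the nonnegative losses of
    single actions at [p]. *)
Lemma lossE p : loss p = \sum_y
  (best_utility u p - utility u p y) * next_mean (fun b => action_prob b y) p.
Proof.
rewrite /loss -[X in X - _]mulr1 -(next_action_sum p) mulr_sumr -sumrB.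
by apply: eq_bigr => y _; ring.
Qed.

Lemma loss_term_ge0 p y :
  0 <= (best_utility u p - utility u p y) * next_mean (fun b => action_prob b y) p.
Proof. by rewrite mulr_ge0 ?next_action_ge0 // subr_ge0 utility_le_best. Qed.

Lemma loss_ge0 p : 0 <= loss p.
Proof. by rewrite lossE; apply: sumr_ge0 => y _; exact: loss_term_ge0. Qed.

Lemma loss_bounded : bounded_mfun loss.
Proof.
apply: bounded_mfunB; first exact: best_utility_bounded.
apply: bounded_mfun_sum => y; apply: bounded_mfunM; last exact: utility_bounded.
exact: next_mean_bounded (action_prob_bounded y).
Qed.

Let increment p := next_mean (best_utility u) p - best_utility u p.

Lemma increment_bounded : bounded_mfun increment.
Proof.
have bh := best_utility_bounded.
by apply: bounded_mfunB => //; exact: next_mean_bounded.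
Qed.

Lemma rand_increment p : gap u delta vS p <= (1 - lam) * increment p /\
  lam * loss p <= (1 - lam) * increment p.
Proof.
have := rand_S_le p; have := gap_ge0 rand_envelope p; have := loss_ge0 p.
have /andP[l0 l1] := lam01; rewrite -(pmulr_rge0 _ l0) /gap /increment /loss.
by move=> *; split; lra.
Qed.

(** The expected increments telescope, leaving two means bounded by [B]. *)
Lemma sum_increments (B : R) beta N : (forall i y, `|u i y| <= B) ->
  \sum_(t < N) \int[P beta]_w increment (a t w) <= 2 * B.
Proof.
move=> uB; have bh := best_utility_bounded.
have -> : \sum_(t < N) \int[P beta]_w increment (a t w) =
    \int[P beta]_w best_utility u (a N w) - \int[P beta]_w best_utility u (a 0%N w).
  elim: N => [|N IH]; first by rewrite big_ord0 subrr.
  rewrite big_ord_recr IH /= (meanB (P1 beta)); last exact: state_bounded_mfun.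
    by rewrite -(mean_next beta (@history_setT N)) //; ring.
  by apply: state_bounded_mfun; exact: next_mean_bounded.
have bound t : `|\int[P beta]_w best_utility u (a t w)| <= B.
  apply: (mean_bound (P1 beta)) => [|w]; first exact: state_bounded_mfun.
  exact: best_utility_bound.
have := bound N; have := bound 0%N; rewrite !ler_norml => /andP[? ?] /andP[? ?]; lra.
Qed.

Lemma rand_gap_vanish beta : {ae P beta, forall w, forall e, 0 < e ->
  \forall t \near \oo, `|gap u delta vS (a t w)| < e}.
Proof.
have [B _ uB] := payoff_bounded u; have /andP[l0 l1] := lam01.
have l1' : 0 <= 1 - lam by lra.
have bg := continuous_bounded_mfun (gap_continuous rand_envelope).
have := @ae_vanish _ _ _ (P beta) (P1 beta) (fun t w => gap u delta vS (a t w))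
  ((1 - lam) * (2 * B)).
have h1 t : bounded_mfun (fun w => gap u delta vS (a t w)) by exact: state_bounded_mfun.
move=> /(_ h1 (fun t w => gap_ge0 rand_envelope (a t w))).
have h2 N : \sum_(t < N) \int[P beta]_w gap u delta vS (a t w) <= (1 - lam) * (2 * B).
  apply: le_trans (ler_wpM2l l1' (sum_increments beta N uB)).
  rewrite mulr_sumr; apply: ler_sum => t _.
  have bi := state_bounded_mfun t increment_bounded.
  rewrite -(meanZ (P1 beta) _ bi); apply: (mean_le (P1 beta) (h1 t)) => [|w].
    exact: bounded_mfunZ.
  exact: (rand_increment (a t w)).1.
move=> /(_ h2); apply: filterS => w gw e e0; apply: filterS (gw e e0) => t.
by rewrite ger0_norm //; exact: (gap_ge0 rand_envelope).
Qed.

Let costly (e : R) y : set (simplex R n) :=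
  [set b | e < best_utility u b - utility u b y].

Lemma costly_measurable e y : measurable (costly e y).
Proof.
apply: simplex_open_measurable.
apply: (@open_comp _ _ (fun b => best_utility u b - utility u b y) [set r | e < r]).
  move=> b _; apply: (@cvgB _ _ _ (nbhs b)); first exact: best_utility_continuous.
  exact: utility_continuous.
exact: open_gt.
Qed.

(** The indicator that the action of period [t.+1] loses more than [e] at the state of period [t],
    written as a sum over actions to separate the two periods. *)
Let costly_action (e : R) t w : R :=
  \sum_y \1_(costly e y) (a t w) * (x t.+1 w == y)%:R.

Lemma costly_action_bounded e t : bounded_mfun (costly_action e t).
Proof.
apply: bounded_mfun_sum => y; apply: bounded_mfunM; last first.
  exact: (@action_bounded_mfun t.+1 (fun y' => (y' == y)%:R)).
apply: (@state_bounded_mfun t (\1_(costly e y))); split.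
  exact: measurable_indic (costly_measurable e y).
by exists 1 => b; rewrite indicE; case: (_ \in _); rewrite ?normr1 ?normr0.
Qed.

(** A Markov inequality for the loss of the next action, conditional on the state at time [t]. *)
Lemma mean_costly_action beta e t : 0 < e ->
  e * \int[P beta]_w costly_action e t w <= \int[P beta]_w loss (a t w).
Proof.
move=> e0; pose N y := next_mean (fun b => action_prob b y).
have bN y : bounded_mfun (N y) by exact: next_mean_bounded (action_prob_bounded y).
have b1 y : bounded_mfun (\1_(costly e y) : simplex R n -> R).
  split; first exact: measurable_indic (costly_measurable e y).
  by exists 1 => b; rewrite indicE; case: (_ \in _); rewrite ?normr1 ?normr0.
have restr y (g : Omega -> R) : \int[P beta]_w (\1_(costly e y) (a t w) * g w) =
    \int[P beta]_(w in [set w | costly e y (a t w)]) g w.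
  rewrite [RHS]Rintegral_mkcond; congr fine; apply: eq_integral => w _.
  rewrite patchE indicE; congr EFin.
  have -> : (w \in [set w | costly e y (a t w)]) = (a t w \in costly e y).
    by apply/idP/idP; rewrite !inE.
  by case: (_ \in _); rewrite ?mul1r ?mul0r.
have -> : \int[P beta]_w costly_action e t w =
    \int[P beta]_w (\sum_y \1_(costly e y) (a t w) * N y (a t w)).
  rewrite (mean_sum (P1 beta)); last first.
    move=> y; apply: bounded_mfunM; first exact: (state_bounded_mfun t (b1 y)).
    exact: (@action_bounded_mfun t.+1 (fun y' => (y' == y)%:R)).
  rewrite (mean_sum (P1 beta)); last first.
    by move=> y; apply: bounded_mfunM;
      [exact: (state_bounded_mfun t (b1 y))|exact: state_bounded_mfun].
  apply: eq_bigr => y _; rewrite !restr.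
  (* The event lies in the histories at [t] and at [t.+1]: the action is first averaged given the
     state at [t.+1], then that state given the one at [t]. *)
  have hH k : (t <= k)%N -> history a x k [set w | costly e y (a t w)].
    by move=> tk; apply: history_state => //; exact: costly_measurable.
  rewrite (mean_action beta (fun y' => (y' == y)%:R) (hH t.+1 (leqnSn t))).
  exact: (mean_next beta (hH t (leqnn t)) (action_prob_bounded y)).
have bs : bounded_mfun (fun w => \sum_y \1_(costly e y) (a t w) * N y (a t w)).
  apply: bounded_mfun_sum => y; apply: bounded_mfunM; first exact: (state_bounded_mfun t (b1 y)).
  exact: state_bounded_mfun.
rewrite -(meanZ (P1 beta) _ bs); apply: (mean_le (P1 beta)) => [||w].
- exact: bounded_mfunZ.
- exact: state_bounded_mfun loss_bounded.
- rewrite lossE mulr_sumr; apply: ler_sum => y _; rewrite mulrA indicE.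
  have [|] := boolP (_ \in _); last by rewrite mulr0 mul0r loss_term_ge0.
  rewrite inE /costly /= mulr1 => lt; apply: ler_wpM2r; first exact: next_action_ge0.
  exact: ltW.
Qed.

(** The expected indicators of costly actions are summable, so almost surely these indicators fall
    below 1 eventually, which means that no costly action occurs any more. *)
Lemma rand_loss_small beta e : 0 < e -> {ae P beta, forall w,
  \forall t \near \oo, best_utility u (a t w) - utility u (a t w) (x t.+1 w) <= e}.
Proof.
move=> e0; have [B _ uB] := payoff_bounded u; have /andP[l0 l1] := lam01.
have l1' : 0 <= 1 - lam by lra.
have F0 t w : 0 <= costly_action e t w.
  by apply: sumr_ge0 => y _; rewrite mulr_ge0 // indicE ler0n.
have sumF N : \sum_(t < N) \int[P beta]_w costly_action e t w <=
    (lam * e)^-1 * ((1 - lam) * (2 * B)).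
  rewrite mulrC ler_pdivlMr ?mulr_gt0 // mulrC.
  apply: le_trans (ler_wpM2l l1' (sum_increments beta N uB)).
  rewrite !mulr_sumr; apply: ler_sum => t _.
  have bi := state_bounded_mfun t increment_bounded.
  have bl := state_bounded_mfun t loss_bounded.
  rewrite -mulrA; apply: le_trans (ler_wpM2l (ltW l0) (mean_costly_action beta t e0)) _.
  rewrite -(meanZ (P1 beta) _ bi) -(meanZ (P1 beta) _ bl).
  apply: (mean_le (P1 beta)) => [||w]; try exact: bounded_mfunZ.
  exact: (rand_increment (a t w)).2.
have := ae_vanish (P1 beta) (fun t => costly_action_bounded e t) F0 sumF.
apply: filterS => w Fw; apply: filterS (Fw 1 ltr01) => t.
rewrite !ltNge; apply: contraNle => lt.
rewrite /costly_action (bigD1 (x t.+1 w)) //= eqxx mulr1 indicE.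
rewrite (mem_set (lt : costly e (x t.+1 w) (a t w))) lerDl.
by apply: sumr_ge0 => y _; rewrite mulr_ge0 // indicE ler0n.
Qed.

Lemma rand_loss_vanish beta : {ae P beta, forall w, forall e, 0 < e ->
  \forall t \near \oo, best_utility u (a t w) - utility u (a t w) (x t.+1 w) < e}.
Proof.
(* Countably many thresholds leave a single null set that serves every [e]. *)
have inv0 m : 0 < m.+1%:R^-1 :> R by rewrite invr_gt0.
have := ae_foralln (fun m => rand_loss_small beta (inv0 m)).
apply: filterS => w lw e e0; apply: filterS (lw (Num.bound e^-1)) => t.
move/le_lt_trans; apply; rewrite invf_plt ?posrE //.
have : e^-1 < (Num.bound e^-1)%:R by apply: archi_boundP; rewrite invr_ge0 ltW.
by move/lt_trans; apply; rewrite ltr_nat.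
Qed.

Lemma rand_equilibrium (Z := stationary_set u delta vS) :
  [/\ Z !=set0 /\ compact Z,
      forall alpha0,
        {ae P alpha0, forall w, cluster ((fun t => a t w) @ \oo) `<=` Z},
      forall p y, Z p -> best_actions u p y ->
        [/\ utility u p y = best_utility u p,
            best_utility u p = max_payoff u y &
            forall i, 0 < weight p i -> u i y = max_payoff u y] &
      unique_maximizers u ->
        forall alpha0, {ae P alpha0, forall w,
          exists j, (fun t => a t w) @ \oo --> vertex R j}].
Proof.
have env := rand_envelope; have /andP[l0 l1] := lam01.
split.
- split; last exact: (stationary_set_compact env).
  apply: (stationary_set_nonempty env) => p pmax.
  (* At a maximizer [p] of the best utility the expected increment is nonpositive, and so is the
     gap. *)
  have [le _] := rand_increment p; rewrite -subr_le0; apply: le_trans le _.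
  rewrite mulr_ge0_le0 //; first by lra.
  rewrite subr_le0 -[leRHS](next_mean_cst _ p).
  apply: next_mean_le => //; first exact: best_utility_bounded.
  exact: bounded_mfun_cst.
- move=> beta; apply: filterS (rand_gap_vanish beta) => w gw q cq.
  apply/stationary_setE.
  by apply: cluster_zero cq; [exact: (gap_continuous env)|exact: gw].
- by move=> p y; exact: (stationary_payoffs lam01 delta01 env).
- move=> un beta.
  move: (ae_best_actions beta) (rand_gap_vanish beta) (rand_loss_vanish beta).
  apply: filterS3 => w bw gw lw.
  exact: (cvg_vertex lam01 delta01 env (a := fun t => a t w) (x := fun t => x t w)).
Qed.

End RandomizedEquilibrium.

Theorem theorem5 (R : realType) (n : nat) (X : pointedFinType)
  (u : 'I_n.+1 -> X -> R) (lam delta : R) :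
  0 < lam < 1 -> 0 < delta < 1 ->
  (forall (phi : simplex R n -> simplex R n) (z : simplex R n -> X),
    pure_MPE u lam delta phi z ->
    let Z := stationary_set u delta (pure_S u lam delta phi z) in
    [/\ Z !=set0 /\ compact Z,
        forall alpha0, cluster (pure_path phi alpha0 @ \oo) `<=` Z,
        forall p x, Z p -> best_actions u p x ->
          [/\ utility u p x = best_utility u p,
              best_utility u p = max_payoff u x &
              forall i, 0 < weight p i -> u i x = max_payoff u x] &
        unique_maximizers u ->
          forall alpha0, exists j, pure_path phi alpha0 @ \oo --> vertex R j]) /\
  (forall (Pi : R.-pker (simplex R n) ~> (discrete_space X * simplex R n)%type)
      (d : measure_display) (Omega : measurableType d)
      (a : nat -> {mfun Omega >-> simplex R n})
      (x : nat -> {mfun Omega >-> discrete_space X})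
      (P : simplex R n -> probability Omega R),
    (forall beta, path_law Pi a x beta (P beta)) ->
    rand_MPE u lam delta Pi a x P ->
    let Z := stationary_set u delta (rand_S u lam delta Pi a x P) in
    [/\ Z !=set0 /\ compact Z,
        forall alpha0,
          {ae P alpha0, forall w, cluster ((fun t => a t w) @ \oo) `<=` Z},
        forall p y, Z p -> best_actions u p y ->
          [/\ utility u p y = best_utility u p,
              best_utility u p = max_payoff u y &
              forall i, 0 < weight p i -> u i y = max_payoff u y] &
        unique_maximizers u ->
          forall alpha0, {ae P alpha0, forall w,
            exists j, (fun t => a t w) @ \oo --> vertex R j}]).
Proof.
move=> lam01 delta01; split=> [phi z mpe|Pi d Omega a x P law mpe].
  exact: pure_equilibrium.
exact: rand_equilibrium.
Qed.
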